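(* Let $l_1\leq l_2\leq\cdots\leq l_m$ be positive integers and $L=l_1+\cdots+l_m+1$. Let $\epsilon_m$ be the sequence of length $2(l_1+\cdots+l_m)$ formed by concatenating $2m$ blocks, where for $r=1,\dots,2m$ the $r$-th block consists of the entry $(-1)^{r-1}$ repeated $n_r$ times, with block lengths $(n_1,\dots,n_{2m})=(l_m,l_{m-1},\dots,l_1,l_1,l_2,\dots,l_m)$. Then there is a bijection between the following two sets: ($\alpha$) the set of pairs $(\sigma,<)$, where $\sigma$ is a non-crossing pairing compatible with $\epsilon_m$ and $<$ is a total order on the vertices of the quotient tree $T_\sigma$ compatible with the orientations of the edges; ($\beta$) the set of tuples $(B_1,\dots,B_m)$ of pairwise disjoint sets with $B_1\cup\cdots\cup B_m=\{1,\dots,L\}$ such that $|B_1|+\cdots+|B_n|\leq l_1+\cdots+l_n$ for each $1\leq n\leq m-1$. (Equivalently, ($\beta$) is in bijection, via $B_j=\{k: a_k=j\}$, with the set of sequences $(a_1,\dots,a_L)\in\{1,\dots,m\}^L$ such that for each $1\leq n\leq m-1$ at most $l_1+\cdots+l_n$ terms of the sequence lie in $\{1,\dots,n\}$.)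
   Context: For $\epsilon=(\epsilon(1),\dots,\epsilon(k))\in\{-1,+1\}^k$, let $G_\epsilon$ be the oriented $k$-gon with vertices $v_1,\dots,v_k$ and edges $e_1,\dots,e_k$, where $e_i$ joins $v_i$ and $v_{i+1}$ (with $v_{k+1}:=v_1$); $e_i$ is oriented from $v_{i+1}$ to $v_i$ if $\epsilon(i)=+1$ and from $v_i$ to $v_{i+1}$ if $\epsilon(i)=-1$. A pairing $\sigma$ of $\{1,\dots,k\}$ is a partition into 2-element blocks; it is compatible with $\epsilon$ if $\epsilon(i)+\epsilon(j)=0$ for every $\{i,j\}\in\sigma$, and non-crossing if there are no $p<q<r<s$ with $\{p,r\},\{q,s\}\in\sigma$. The quotient graph $T_\sigma$ is obtained from $G_\epsilon$ by gluing, for each $\{i,j\}\in\sigma$, edge $e_i$ to edge $e_j$ so that $v_i$ is identified with $v_{j+1}$ and $v_{i+1}$ with $v_j$ (vertex identifications generated by these); each edge of $T_\sigma$ inherits the common orientation of the two edges it comes from. For non-crossing $\sigma$, $T_\sigma$ is a tree. For vertices $x,y$ write $x\prec y$ if there is a nonempty directed path from $y$ to $x$ following the arrows. A total order $<$ on the vertices of $T_\sigma$ is compatible with the orientations of the edges if $x\prec y$ implies $x<y$. *)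

(* Defs.v *)
From HB Require Import structures.
From mathcomp Require Import all_boot all_order all_algebra.

Set Implicit Arguments.
Unset Strict Implicit.
Unset Printing Implicit Defensive.

Import Order.TTheory GRing.Theory Num.Theory.

(* Indices are 0-based: i : 'I_k stands for the vertex v_{i+1} or for the edge
   e_{i+1} of the k-gon, and [ordS i] (successor modulo k) for the next one, so
   the edge i joins the vertices i and [ordS i]. *)
Section Polygon.

Variables (k : nat) (eps : k.-tuple int).

Definition source (i : 'I_k) : 'I_k :=
  if tnth eps i == 1%R then ordS i else i.

Definition target (i : 'I_k) : 'I_k :=
  if tnth eps i == 1%R then i else ordS i.

Definition pairing (sigma : {set {set 'I_k}}) : bool :=
  partition sigma [set: 'I_k] && [forall B in sigma, #|B| == 2].

Definition compatible (sigma : {set {set 'I_k}}) : bool :=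
  [forall i, forall j,
     ([set i; j] \in sigma) ==> (tnth eps i + tnth eps j == 0)%R].

Definition noncrossing (sigma : {set {set 'I_k}}) : bool :=
  ~~ [exists p : 'I_k, exists q : 'I_k, exists r : 'I_k, exists s : 'I_k,
       [&& p < q, q < r, r < s, [set p; r] \in sigma & [set q; s] \in sigma]].

Definition glued (sigma : {set {set 'I_k}}) : rel 'I_k := fun x y =>
  [exists i, exists j, ([set i; j] \in sigma) &&
     (((x == i) && (y == ordS j)) || ((x == ordS i) && (y == j)))].

(* The vertices of the quotient graph are the classes of the equivalence
   relation generated by [glued], as subsets of the polygon's vertex set. *)
Definition quotient_vertices (sigma : {set {set 'I_k}}) : {set {set 'I_k}} :=
  equivalence_partition
    (connect [rel x y | glued sigma x y || glued sigma y x]) [set: 'I_k].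

(* The edge of the quotient graph coming from {i, j} \in sigma appears twice
   here, via i and via j; both give the same arrow if sigma is compatible. *)
Definition arrow (sigma : {set {set 'I_k}}) : rel {set 'I_k} := fun y x =>
  [exists i, (y == pblock (quotient_vertices sigma) (source i)) &&
             (x == pblock (quotient_vertices sigma) (target i))].

(* There is a nonempty directed path from y to x. *)
Definition prec (sigma : {set {set 'I_k}}) (x y : {set 'I_k}) : bool :=
  [exists z, arrow sigma y z && connect (arrow sigma) z x].

(* lt is the graph of the order: (x, y) \in lt means x < y. *)
Definition strict_total_order (T : finType) (V : {set T}) (lt : {set T * T}) :
    bool :=
  [&& lt \subset setX V V,
      [forall x in V, (x, x) \notin lt],
      [forall x in V, forall y in V, forall z in V,
         ((x, y) \in lt) && ((y, z) \in lt) ==> ((x, z) \in lt)]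
    & [forall x in V, forall y in V,
         (x != y) ==> ((x, y) \in lt) || ((y, x) \in lt)]].

Definition order_compatible (sigma : {set {set 'I_k}})
    (lt : {set {set 'I_k} * {set 'I_k}}) : bool :=
  [forall x in quotient_vertices sigma, forall y in quotient_vertices sigma,
     prec sigma x y ==> ((x, y) \in lt)].

Definition ordered_trees :
    {set {set {set 'I_k}} * {set {set 'I_k} * {set 'I_k}}} :=
  [set p | [&& pairing p.1, noncrossing p.1, compatible p.1,
               strict_total_order (quotient_vertices p.1) p.2
             & order_compatible p.1 p.2]].

End Polygon.

Section Blocks.

Variables (m : nat) (l : m.-tuple nat).

Definition block_lengths : seq nat := rev l ++ l.

(* 0-based block number r, so the first block consists of +1's. *)
Definition eps_seq : seq int :=
  flatten (mkseq (fun r => nseq (nth 0 block_lengths r) ((-1) ^+ r)%R) (2 * m)).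

Lemma size_eps_seq : size eps_seq == 2 * sumn l.
Proof.
have sbl : size block_lengths = 2 * m.
  by rewrite size_cat size_rev size_tuple addnn mul2n.
rewrite /eps_seq size_flatten /shape /mkseq -map_comp.
rewrite (eq_map (g := nth 0 block_lengths)); last by move=> r /=; rewrite size_nseq.
rewrite -sbl -/(mkseq _ _) mkseq_nth sumn_cat sumn_rev.
by rewrite addnn mul2n.
Qed.

Definition eps_tuple : (2 * sumn l).-tuple int := Tuple size_eps_seq.

(* {1, ..., L} is represented by 'I_L with L = l_1 + ... + l_m + 1, and B_{j+1}
   is B j for j : 'I_m. *)
Definition set_tuples : {set {ffun 'I_m -> {set 'I_(sumn l).+1}}} :=
  [set B : {ffun 'I_m -> {set 'I_(sumn l).+1}} |
    [&& [forall i, forall j, (i != j) ==> [disjoint B i & B j]],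
        \bigcup_(j < m) B j == [set: 'I_(sumn l).+1]
      & [forall n : 'I_m, (1 <= n) ==>
           (\sum_(j < m | j < n) #|B j| <= \sum_(j < m | j < n) tnth l j)]]].

Definition sequences : {set {ffun 'I_(sumn l).+1 -> 'I_m}} :=
  [set a : {ffun 'I_(sumn l).+1 -> 'I_m} |
    [forall n : 'I_m, (1 <= n) ==>
       (#|[set i | a i < n]| <= \sum_(j < m | j < n) tnth l j)]].

Definition fibers (a : {ffun 'I_(sumn l).+1 -> 'I_m}) :
    {ffun 'I_m -> {set 'I_(sumn l).+1}} :=
  [ffun j => [set i | a i == j]].

End Blocks.

Definition bijection_between (S T : finType) (A : {set S}) (B : {set T})
    (f : S -> T) : Prop :=
  {in A &, injective f} /\ f @: A = B.

(* Main.v *)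
(* Let theta_0, ..., theta_(L-1) be commuting weights of square zero, so that the
   coefficient of their product Theta only sees labellings using every label once.
   For a word w of signs and a cut 0 <= x <= L, let E_w(x) be the sum, over the
   noncrossing pairings compatible with w and the monotone labellings of the
   non-root vertices of the quotient tree, of the products of weights, the root
   sitting at the cut x (labels < x are below it).  The matrix F(x) of the values
   of E on all subwords satisfies F = 1 + A U B F + B V A F, with A, B the matrices
   of the two letters, U(x) = sum_(y >= x) theta_y F(y) and
   V(x) = sum_(y < x) theta_y F(y); inverting it gives the discrete differential equation
     F(x+1) - F(x) = - theta_x F (A F B - B F A) F.
   Selecting k letters of the word and filling the gaps with F gives
   S_k = F ((A + B) F)^k, for which the right-hand side telescopes; on a word whose
   path stays above its start only S_k(x+1) - S_k(x) = - theta_x S_(k+2) is left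
   (with the opposite sign for a path staying below), so that the value of S_k at
   one extreme cut is sum_r e_r(theta) S_(k+2r) at the other one.  Where no edge can
   leave the root in the direction of the outer runs a^l ... b^l of a word, all the letters of
   these runs must be selected, so S_(2(n+l)) of the word is S_(2n) of its interior,
   a path on the other side of its start, for which this cut is the opposite extreme.
   Peeling the nested blocks one after the other thus yields
     #(alpha) Theta = sum_(b_1, ..., b_m) prod_i e_(b_i)(theta) = #(beta) Theta,
   over b_1 + ... + b_m = L with b_1 + ... + b_n <= l_1 + ... + l_n for n < m. *)

Require Import Defs.
From HB Require Import structures.
From mathcomp Require Import all_boot all_order all_algebra.
From mathcomp Require Import zify ring.

Set Implicit Arguments.
Unset Strict Implicit.
Unset Printing Implicit Defensive.

Import Order.TTheory GRing.Theory Num.Theory.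

Local Open Scope ring_scope.

(** * Square-zero differential equation for noncrossing words *)

(** Leibniz rule: the second-order term carries [t * t] and drops out. *)
Lemma mul_square0 (R : comNzRingType) n (t : R) (f g X Y S : 'M[R]_n.+1) :
  t * t = 0 ->
  (f - t *: Y) * g * (S - t *: X) = f * g * S - t *: (Y * g * S + f * g * X).
Proof.
move=> t2; rewrite !mulrBl !mulrBr -!scalerAl -!scalerAr scalerA t2 scale0r.
by rewrite subr0 scalerDr opprD addrA addrAC.
Qed.

Section Flow.
Variables (R : comNzRingType) (theta : nat -> R) (L n : nat).
Hypothesis theta2 : forall x, theta x * theta x = 0.
Variables (A B : 'M[R]_n.+1) (F : nat -> 'M[R]_n.+1).
Let U x := \sum_(x <= y < L) theta y *: F y.
Let V x := \sum_(0 <= y < x) theta y *: F y.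
Hypothesis F_eq : forall x, (x <= L)%N ->
  F x = 1 + A * U x * B * F x + B * V x * A * F x.
Let K x := 1 - A * U x * B - B * V x * A.

Let KF x : (x <= L)%N -> K x * F x = 1.
Proof.
move=> lxL; rewrite /K !mulrBl mul1r -addrA -opprD {1}(F_eq lxL).
by rewrite -[1 + _ + _]addrA addrK.
Qed.

Let FK x : (x <= L)%N -> F x * K x = 1.
Proof. by move=> lxL; apply: mulmx1C; exact: KF. Qed.

(** [F_eq] says that [F x] is a right inverse of [K x]; for square matrices over a commutative ring
    it is then a left inverse too. This turns the decomposition at the first edge of the root into
    one at the last edge. *)
Lemma flow_eqr x : (x <= L)%N ->
  F x = 1 + F x * A * U x * B + F x * B * V x * A.
Proof.
move=> lxL; have := FK lxL; rewrite /K !mulrBr mulr1 => <-.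
rewrite !mulrA; set p := _ * B; set q := _ * A.
by apply/matrixP=> i j; rewrite !mxE; ring.
Qed.

(** Resolvent identity: moving the cut past [x] transfers one summand from [U] to [V], which changes
    [K] by a multiple of [theta x]. The right-hand side is written with [A + B], the two terms with
    [A] twice cancelling, so that it telescopes in [flow_words_step]. *)
Lemma flow_step x : (x < L)%N ->
  F x.+1 = F x - theta x *: (F x * A * F x * (A + B) * F x
                             - F x * (A + B) * F x * A * F x).
Proof.
move=> ltxL; set C := A * F x * B - B * F x * A.
have dK : K x - K x.+1 = - (theta x *: C).
  rewrite /K /U /V (big_ltn ltxL) big_nat_recr //= -/(U x.+1) -/(V x).
  rewrite /C !(mulrDl, mulrDr) -!scalerAr -!scalerAl.
  by apply/matrixP=> i j; rewrite !mxE; ring.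
have dF : F x.+1 - F x = - (theta x *: (F x.+1 * C * F x)).
  have -> : F x.+1 - F x = F x.+1 * (K x - K x.+1) * F x.
    rewrite mulrBr mulrBl FK // mul1r -mulrA KF ?mulr1 //; exact: ltnW.
  by rewrite dK mulrN mulNr -scalerAr -scalerAl.
(* Since [theta x] squares to zero, a factor [theta x] makes the two neighbouring cuts
   indistinguishable; the remaining [F x.+1] can be replaced by [F x]. *)
have tF : theta x *: F x.+1 = theta x *: F x.
  apply/eqP; rewrite -subr_eq0 -scalerBr dF scalerN scalerA theta2.
  by rewrite scale0r oppr0.
apply/eqP; rewrite addrC -subr_eq; apply/eqP; rewrite dF !scalerAl tF.
congr (- _); rewrite -!scalerAl; congr (_ *: _).
rewrite /C !(mulrDl, mulrDr, mulrN, mulNr) !mulrA.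
by apply/matrixP=> i j; rewrite !mxE; ring.
Qed.

(* [S_k], at the cut [x]. *)
Definition flow_words k x := iter k (fun S => F x * (A + B) * S) (F x).

Lemma flow_wordsS k x :
  flow_words k.+1 x = F x * (A + B) * flow_words k x.
Proof. by []. Qed.

Lemma flow_wordsSr k x :
  flow_words k.+1 x = flow_words k x * (A + B) * F x.
Proof.
elim: k => [|k IHk]; first by [].
by rewrite flow_wordsS [in LHS]IHk [in RHS]flow_wordsS !mulrA.
Qed.

(** Leibniz on [F x * (A + B) * flow_words k x]: each factor yields a term with [A] at its left end
    and one with [A] at its right end, and the two meeting in the middle cancel because both equal
    S_1 A S_(k+1). *)
Lemma flow_words_step k x : (x < L)%N ->
  flow_words k x.+1 = flow_words k x
    - theta x *: (F x * A * flow_words k.+1 x - flow_words k.+1 x * A * F x).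
Proof.
move=> ltxL; elim: k => [|k IHk].
  by rewrite /= (flow_step ltxL) !mulrA.
rewrite flow_wordsS IHk (flow_step ltxL).
set S := flow_words k x; set t := theta x; set S1 := flow_words k.+1 x.
have t2 : t * t = 0 by exact: theta2.
have -> : flow_words k.+2 x = F x * (A + B) * S1 by [].
have eS1 : F x * (A + B) * S = S1 by [].
have eSr : S1 * (A + B) * F x = F x * (A + B) * S1.
  by rewrite -flow_wordsSr.
move: (F x) S S1 eS1 eSr => f S S1 eS1 eSr.
rewrite mul_square0 // eS1; congr (_ - _ *: _).
rewrite -eS1; move: (A + B) => g.
by rewrite !(mulrBl, mulrBr) !mulrA addrA subrK.
Qed.

End Flow.

(** * Heights of a path and matrices indexed by its subwords *)

Section Path.
Variables (R : comNzRingType) (W : nat -> bool) (n : nat).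
Implicit Types (i j : 'I_n.+1).

(** Advances one position of [W] when the letter read there is [c]; products of such matrices with
    matrices indexed by subwords sum over the ways of cutting a word. *)
Definition letter_mx (c : bool) : 'M[R]_n.+1 :=
  \matrix_(i, j) ((j == i.+1 :> nat) && (W i == c))%:R.

Fixpoint height (p : nat) : int :=
  if p is q.+1 then height q + (if W q then 1 else -1) else 0.

Definition balanced_mx (M : 'M[R]_n.+1) :=
  forall i j, ~~ ((i <= j)%N && (height i == height j)) -> M i j = 0.

Definition upper_mx (M : 'M[R]_n.+1) := forall i j, (j < i)%N -> M i j = 0.

Lemma balanced_upper M : balanced_mx M -> upper_mx M.
Proof. by move=> bM i j ltji; apply: bM; rewrite leqNgt ltji. Qed.

Lemma upper_mul M N : upper_mx M -> upper_mx N -> upper_mx (M * N).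
Proof.
move=> uM uN i j ltji; rewrite mxE big1 // => p _.
case: (ltnP p i) => [ltpi|leip]; first by rewrite uM // mul0r.
by rewrite uN ?mulr0 //; exact: leq_trans leip.
Qed.

Lemma upper_letter c : upper_mx (letter_mx c).
Proof.
by move=> i j ltji; rewrite mxE; case: eqP => // eji; move: ltji; rewrite eji ltnNge leqnSn.
Qed.

Lemma upperD M N : upper_mx M -> upper_mx N -> upper_mx (M + N).
Proof. by move=> uM uN i j ltji; rewrite mxE uM ?uN ?addr0. Qed.

Lemma mul_letter_neq0 M c i p :
  balanced_mx M -> (M * letter_mx c) i p != 0 ->
  (i < p)%N /\ height p = height i + (if c then 1 else -1).
Proof.
move=> bM; rewrite mxE => nz.
have [q /andP[Mq]] : exists q : 'I_n.+1, (M i q != 0) && (letter_mx c q p != 0).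
  apply/existsP; apply: contraNT nz => /existsPn z; rewrite big1 // => q _.
  by have := z q; rewrite negb_and !negbK => /orP[] /eqP->; rewrite ?mul0r ?mulr0.
have /andP[leiq /eqP->] : (i <= q)%N && (height i == height q).
  by apply: contraNT Mq => /bM ->.
rewrite mxE; case: (nat_of_ord p =P q.+1) => [->|_]; last by rewrite eqxx.
by case: (W q =P c) => [<-|_]; last by rewrite eqxx.
Qed.

Lemma letter_mul_neq0 M c p j :
  balanced_mx M -> (letter_mx c * M) p j != 0 ->
  (p < j)%N /\ height j = height p + (if c then 1 else -1).
Proof.
move=> bM; rewrite mxE => nz.
have [q /andP[pq Mq]] : exists q : 'I_n.+1, (letter_mx c p q != 0) && (M q j != 0).
  apply/existsP; apply: contraNT nz => /existsPn z; rewrite big1 // => q _.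
  by have := z q; rewrite negb_and !negbK => /orP[] /eqP->; rewrite ?mul0r ?mulr0.
have /andP[leqj /eqP<-] : (q <= j)%N && (height q == height j).
  by apply: contraNT Mq => /bM ->.
move: pq leqj; rewrite mxE.
case: (nat_of_ord q =P p.+1) => [->|_]; last by rewrite eqxx.
case: (W p =P c) => [<- _ ltpj|_]; last by rewrite eqxx.
by [].
Qed.

Definition excursion (a : bool) (i j : nat) :=
  height i = height j /\
  forall p, (i <= p <= j)%N ->
    if a then height i <= height p else height p <= height i.

(** A balanced factor returns to the starting height, so reading the letter [~~ a] next would put
    the path on the forbidden side. *)
Lemma mul_letter_excursion M N a i j : excursion a i j ->
  balanced_mx M -> upper_mx N -> (M * letter_mx (~~ a) * N) i j = 0.
Proof.
move=> [_ exc] bM uN; rewrite mxE big1 // => p _.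
case: (ltnP j p) => [/uN->|lepj]; first by rewrite mulr0.
have [->|/(mul_letter_neq0 bM)[ltip hp]] := eqVneq ((M * letter_mx (~~ a)) i p) 0.
  by rewrite mul0r.
have := exc p; rewrite (ltnW ltip) lepj hp => /(_ isT).
by case: (a) => /=; lia.
Qed.

(** Seen from the end, the letter [a] followed by a balanced factor would have to start on the
    forbidden side of the final height. *)
Lemma excursion_letter_mul M N a i j : excursion a i j ->
  balanced_mx M -> upper_mx N -> (N * (letter_mx a * M)) i j = 0.
Proof.
move=> [hij exc] bM uN; rewrite mxE big1 // => p _.
case: (ltnP p i) => [/uN->|leip]; first by rewrite mul0r.
have [->|/(letter_mul_neq0 bM)[ltpj hp]] := eqVneq ((letter_mx a * M) p j) 0.
  by rewrite mulr0.
have := exc p; rewrite leip (ltnW ltpj) => /(_ isT).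
by move: hp; rewrite -hij; case: (a) => /=; lia.
Qed.
End Path.

(** * Elementary symmetric polynomials and iteration of the recurrence *)

Section Expansion.
Variable R : comNzRingType.

(** The elementary symmetric polynomial e_r(t_0, ..., t_(d-1)), read off its generating function. *)
Definition elem_sym (t : nat -> R) (d r : nat) : R :=
  (\prod_(0 <= i < d) (1 + t i *: 'X))`_r.

Lemma elem_sym0 t d : elem_sym t d 0 = 1.
Proof.
rewrite /elem_sym; elim: d => [|d IHd]; first by rewrite big_geq // coef1.
rewrite big_nat_recr //= mulrDr mulr1 coefD IHd -scalerAr coefZ coefMX /=.
by rewrite mulr0 addr0.
Qed.

Lemma elem_symSS t d r : elem_sym t d.+1 r.+1 = elem_sym t d r.+1 + t d * elem_sym t d r.
Proof.
by rewrite /elem_sym big_nat_recr //= mulrDr mulr1 coefD -scalerAr coefZ coefMX.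
Qed.

Lemma elem_sym_rev t d r : elem_sym (fun i => t (d - i.+1)%N) d r = elem_sym t d r.
Proof. by rewrite /elem_sym [in RHS]big_nat_rev add0n. Qed.

(** Going from 0 to [d], each step either keeps [q] or raises it at the cost of a factor [t e];
    raising it at [r] of the [d] steps contributes e_r in total. *)
Lemma ode_expansion (t : nat -> R) (g : nat -> nat -> R) d N q :
  (forall q e, (e < d)%N -> g q e.+1 = g q e + t e * g q.+1 e) -> (d < N)%N ->
  g q d = \sum_(0 <= r < N) elem_sym t d r * g (q + r)%N 0%N.
Proof.
elim: d N q => [|d IHd] [|N] q // rec ltdN.
  rewrite big_nat_recl // elem_sym0 mul1r addn0 big1_seq ?addr0 // => r _.
  by rewrite /elem_sym big_geq // coef1 mul0r.
have rec' q' e : (e < d)%N -> g q' e.+1 = g q' e + t e * g q'.+1 e.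
  by move=> lted; apply: rec; exact: ltnW.
(* One sum gets [N.+1] terms and the other [N]: once r = 0 is split off, they match term by term
   through [elem_symSS]. *)
rewrite rec // (IHd N.+1 q) //; last exact: ltnW.
rewrite (IHd N q.+1) // mulr_sumr.
rewrite big_nat_recl // [in RHS]big_nat_recl // !elem_sym0 -addrA; congr (_ + _).
rewrite -big_split /=; apply: eq_bigr => r _.
by rewrite elem_symSS mulrDl addnS addSn mulrA.
Qed.

End Expansion.

(** * The sums S_k on excursions and at extreme cuts *)

Section Words.
Variables (R : comNzRingType) (theta : nat -> R) (L n : nat) (W : nat -> bool).
Hypothesis theta2 : forall x, theta x * theta x = 0.
Variable F : nat -> 'M[R]_n.+1.
Let A := letter_mx R W n true.
Let B := letter_mx R W n false.
Let U x := \sum_(x <= y < L) theta y *: F y.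
Let V x := \sum_(0 <= y < x) theta y *: F y.
Hypothesis F_bal : forall x, (x <= L)%N -> balanced_mx W (F x).
Hypothesis F_eq : forall x, (x <= L)%N ->
  F x = 1 + A * U x * B * F x + B * V x * A * F x.
Let S := flow_words A B F.

Lemma upper_words k x : (x <= L)%N -> upper_mx (S k x).
Proof.
move=> lexL; have uF := balanced_upper (F_bal lexL).
rewrite /S; elim: k => [|k IHk] //; rewrite flow_wordsS.
by apply: upper_mul => //; apply: upper_mul => //; apply: upperD; apply: upper_letter.
Qed.

(** On an excursion one of the two terms of [flow_words_step] vanishes. In the other one [A] may be
    replaced by [A + B], as the part with [B] vanishes too, and this is S_(k+2). *)
Lemma words_step a k x (i j : 'I_n.+1) : (x < L)%N -> excursion W a i j ->
  S k x.+1 i j = S k x i j + (if a then - theta x else theta x) * S k.+2 x i j.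
Proof.
move=> ltxL exc; have lexL := ltnW ltxL.
have bF := F_bal lexL.
have Sr : S k.+2 x = S k.+1 x * (A * F x) + S k.+1 x * (B * F x).
  by rewrite /S flow_wordsSr -mulrA -mulrDr -mulrDl.
have Sl : S k.+2 x = F x * A * S k.+1 x + F x * B * S k.+1 x.
  by rewrite /S flow_wordsS -mulrDl -mulrDr.
have uS := upper_words k.+1 lexL.
rewrite {1}/S (flow_words_step theta2 F_eq) // -/S -[_ * A * F x]mulrA.
rewrite [LHS]mxE; congr (_ + _).
rewrite [X in X = _]mxE [X in - X]mxE [X in _ * X]mxE [X in _ * (_ + X)]mxE.
move: exc bF uS; case: a => exc bF uS.
  rewrite Sl [in RHS]mxE (mul_letter_excursion exc bF uS).
  by rewrite (excursion_letter_mul exc bF uS) subr0 addr0 mulNr.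
rewrite Sr [in RHS]mxE (mul_letter_excursion exc bF uS) (excursion_letter_mul exc bF uS).
by rewrite sub0r addr0 mulrN opprK.
Qed.

Lemma words_expansion a k (i j : 'I_n.+1) N : excursion W a i j -> (L < N)%N ->
  S k (if a then 0 else L) i j =
  \sum_(0 <= r < N) elem_sym theta L r * S (k + r.*2)%N (if a then L else 0) i j.
Proof.
move=> exc ltLN.
case: a exc => exc.
  (* The sign is negative for [a] true, so the cuts are run downwards from [L], where the recurrence
     becomes additive; square zero lets S_(k+2) be read at the cut already reached. *)
  pose g q d := S (k + q.*2)%N (L - d)%N i j.
  have -> : S k 0 i j = g 0 L by rewrite /g addn0 subnn.
  rewrite (@ode_expansion R (fun i => theta (L - i.+1)%N) g L N) // => [|q e lteL].
    by apply: eq_bigr => r _; rewrite elem_sym_rev /g subn0 add0n.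
  rewrite /g; have lt : (L - e.+1 < L)%N by lia.
  have -> : (L - e = (L - e.+1).+1)%N by lia.
  rewrite !(words_step _ lt exc) doubleS !addnS mulrDr mulrA mulrN theta2.
  by rewrite oppr0 mul0r addr0 mulNr subrK.
pose g q d := S (k + q.*2)%N d i j.
have -> : S k L i j = g 0 L by rewrite /g addn0.
rewrite (@ode_expansion R theta g L N) // => q e lteL.
by rewrite /g (words_step _ lteL exc) doubleS !addnS.
Qed.

(** The partial sums over the root label obey the same recurrence with S_0 as their next level, so
    they extend the chain S_0, S_2, ... by one level below; this shifts the index of [elem_sym] by
    one. *)
Lemma sum_words_expansion (i j : 'I_n.+1) N : excursion W true i j -> (L <= N)%N ->
  \sum_(0 <= x < L) theta x * F x i j =
  \sum_(0 <= r < N) elem_sym theta L r.+1 * S r.*2 L i j.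
Proof.
move=> exc leLN; pose t x := theta (L - x.+1)%N.
pose g q d := if q is q'.+1 then S q'.*2 (L - d)%N i j
  else \sum_(0 <= x < d) t x * S 0 (L - x)%N i j.
have -> : \sum_(0 <= x < L) theta x * F x i j = g 0 L.
  rewrite /g /= big_nat_rev /= add0n; apply: eq_big_nat => x /andP[_ ltxL].
  rewrite /t; have lt : (L - x.+1 < L)%N by lia.
  have -> : (L - x = (L - x.+1).+1)%N by lia.
  rewrite -[F _.+1]/(S 0 _.+1) (words_step _ lt exc).
  by rewrite mulrDr mulrA mulrN theta2 oppr0 mul0r addr0.
rewrite (@ode_expansion R t g L N.+1) // => [|[|q] e lteL].
- rewrite big_nat_recl //= big_geq // mulr0 add0r; apply: eq_bigr => r _.
  by rewrite elem_sym_rev subn0.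
- by rewrite /g big_nat_recr.
rewrite /g /t; have lt : (L - e.+1 < L)%N by lia.
have -> : (L - e = (L - e.+1).+1)%N by lia.
rewrite !(words_step _ lt exc) doubleS mulrDr mulrA mulrN theta2.
by rewrite oppr0 mul0r addr0 mulNr subrK.
Qed.

(** At the cut [x] no edge can leave the root in the direction [a], so row [i] and column [j] of
    [F x] are those of the identity: the first and last letters have to be selected, which S_0 and
    S_1 cannot do. *)
Lemma words_top a k (i j i' j' : 'I_n.+1) :
  i' = i.+1 :> nat -> j = j'.+1 :> nat -> (i' <= j')%N ->
  W i = a -> W j' = ~~ a ->
  let x := if a then L else 0%N in
  [/\ S 0 x i j = 0, S 1 x i j = 0 & S k.+2 x i j = S k x i' j'].
Proof.
move=> ei ej leij Wi Wj x.
have lexL : (x <= L)%N by rewrite /x; case: (a).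
(* Of the two arch terms one contains an empty sum at this cut, and the other starts with the letter
   that [W] does not have at [i]. *)
have row q : F x i q = (i == q)%:R.
  rewrite F_eq // /x -!mulrA; case: a Wi {Wj x lexL} => Wi.
    rewrite /U big_geq // !(mul0r, mulr0) addr0 !mxE big1 ?addr0 // => p _.
    by rewrite !mxE Wi andbF mul0r.
  rewrite /V big_geq // !(mul0r, mulr0) addr0 !mxE big1 ?addr0 // => p _.
  by rewrite !mxE Wi andbF mul0r.
(* The letter before [j] is controlled by the factor on the right, hence the mirrored equation
   [flow_eqr]. *)
have col q : F x q j = (q == j)%:R.
  rewrite (flow_eqr F_eq) // /x; case: a Wj {Wi x lexL row} => Wj.
    rewrite big_geq // !(mul0r, mulr0) addr0 !mxE big1 ?addr0 // => p _.
    by rewrite !mxE ej eqSS; case: eqP => [<-|]; rewrite ?Wj mulr0.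
  rewrite [X in _ * X * A]big_geq // !(mul0r, mulr0) addr0 !mxE big1 ?addr0 // => p _.
  by rewrite !mxE ej eqSS; case: eqP => [<-|]; rewrite ?Wj mulr0.
have AB p q : (A + B) p q = (q == p.+1 :> nat)%:R.
  by rewrite !mxE; case: eqP => _ //=; rewrite ?addr0 //; case: (W p); rewrite ?addr0 ?add0r.
have Srow l q : S l.+1 x i q = S l x i' q.
  rewrite /S flow_wordsS -mulrA mxE (bigD1 i) //= row eqxx mul1r big1 ?addr0.
    rewrite mxE (bigD1 i') //= AB ei eqxx mul1r big1 ?addr0 // => p.
    by rewrite AB -ei -val_eqE => /negPf->; rewrite mul0r.
  by move=> p; rewrite eq_sym row => /negPf->; rewrite mul0r.
have Scol l q : S l.+1 x q j = S l x q j'.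
  rewrite /S flow_wordsSr mxE (bigD1 j) //= col eqxx mulr1 big1 ?addr0.
    rewrite mxE (bigD1 j') //= AB ej eqxx mulr1 big1 ?addr0 // => p.
    by rewrite AB ej eqSS eq_sym -val_eqE => /negPf->; rewrite mulr0.
  by move=> p; rewrite col => /negPf->; rewrite mulr0.
have S0 q : q != j -> S 0 x q j = 0 by move=> /negPf ne; rewrite /S /= col ne.
split.
- by apply: S0; rewrite -val_eqE /=; apply/eqP; lia.
- by rewrite Srow; apply: S0; rewrite -val_eqE /=; apply/eqP; lia.
- by rewrite Srow Scol.
Qed.

Hypothesis F_diag : forall x i, (x <= L)%N -> F x i i = 1.

(** There are not enough letters in the word to select [k] of them. *)
Lemma words_short k x (i j : 'I_n.+1) :
  (x <= L)%N -> (j < i + k)%N -> S k x i j = 0.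
Proof.
move=> lexL; elim: k i => [|k IHk] i ltj.
  by rewrite addn0 in ltj; apply: (balanced_upper (F_bal lexL)).
rewrite /S flow_wordsS -mulrA mxE big1 // => p _.
case: (ltnP p i) => [ltpi|leip].
  by rewrite (balanced_upper (F_bal lexL)) ?mul0r.
rewrite mxE big1 ?mulr0 // => q _; rewrite !mxE.
case: (nat_of_ord q =P p.+1) => [eq|_] /=; last by rewrite addr0 mul0r.
by rewrite [flow_words _ _ _ _ _ _ _]IHk ?mulr0 // eq; lia.
Qed.

Lemma words_diag k x (i : 'I_n.+1) : (x <= L)%N -> S k x i i = (k == 0%N)%:R.
Proof.
move=> lexL; case: k => [|k]; first exact: F_diag.
by rewrite words_short //; lia.
Qed.

(** Each of the [c] outer pairs of letters absorbs two of the [q.*2] selected ones; with [q < c] the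
    supply runs out. *)
Lemma words_top_iter a c q (i j i' j' : 'I_n.+1) :
  i' = (i + c)%N :> nat -> j = (j' + c)%N :> nat -> (i' <= j')%N ->
  (forall p, (i <= p < i')%N -> W p = a) ->
  (forall p, (j' <= p < j)%N -> W p = ~~ a) ->
  let x := if a then L else 0%N in
  S q.*2 x i j = if (q < c)%N then 0 else S (q - c).*2 x i' j'.
Proof.
move=> ei ej lei Wi Wj x; elim: c q i j ei ej Wi Wj => [|c IHc] q i j ei ej Wi Wj.
  rewrite subn0; congr (S _ _ _ _); apply: val_inj => /=; lia.
have lti : (i.+1 < n.+1)%N by have := ltn_ord i'; lia.
have ltj : (j.-1 < n.+1)%N by have := ltn_ord j; lia.
have [] := @words_top a q.-1.*2 i j (Ordinal lti) (Ordinal ltj) => //=; try lia.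
- by apply: Wi; lia.
- by apply: Wj; lia.
move=> S0 _ S2; case: q S2 => [|q] S2; first exact: S0.
rewrite doubleS S2 /= (IHc q (Ordinal lti) (Ordinal ltj)) //=; try lia.
- by move=> p Hp; apply: Wi; lia.
- by move=> p Hp; apply: Wj; lia.
Qed.

End Words.

(** * Shape of the path of a nested word *)

Section Nested.
Variables (m : nat) (l : nat -> nat).
Hypothesis l_le : forall r q, (r <= q < m)%N -> (l r <= l q)%N.

Definition depth r := (\sum_(0 <= q < r) l q)%N.

Lemma depth0 : depth 0 = 0%N.
Proof. by rewrite /depth big_geq. Qed.

Lemma depthS r : depth r.+1 = (depth r + l r)%N.
Proof. by rewrite /depth big_nat_recr. Qed.

Lemma depth_le r : (r <= m)%N -> (depth r <= depth m)%N.
Proof. by move=> lerm; rewrite /depth (big_cat_nat (leq0n r) lerm) /= leq_addr. Qed.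

(* The r-th interior word occupies the positions from [depth m - depth r] to
   [depth m + depth r]; [up_level r] tells that it starts with +. *)
Definition up_level r := odd r == odd m.

Lemma up_levelS r : up_level r.+1 = ~~ up_level r.
Proof. by rewrite /up_level /=; case: (odd r) (odd m) => [] []. Qed.

Definition nested_word (W : nat -> bool) := forall r, (r < m)%N ->
  (forall p, (depth m - depth r.+1 <= p < depth m - depth r)%N ->
     W p = up_level r.+1) /\
  (forall p, (depth m + depth r <= p < depth m + depth r.+1)%N ->
     W p = ~~ up_level r.+1).

Lemma height_run W a p c :
  (forall q, (p <= q < p + c)%N -> W q = a) ->
  height W (p + c) = height W p + (if a then c%:Z else - c%:Z).
Proof.
elim: c => [|c IHc] Wp; first by rewrite addn0; case: a Wp; rewrite ?oppr0 addr0.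
rewrite addnS /= IHc => [|q Hq]; last by apply: Wp; lia.
by rewrite Wp ?leq_addr ?addnS //=; case: (a); lia.
Qed.

(** The left run moves away from the start by [l r]; the interior word then comes back by at most
    the length of the preceding run, which does not exceed [l r] because the lengths increase. *)
Lemma nested_excursion W : nested_word W -> forall r, (r <= m)%N ->
  excursion W (up_level r) (depth m - depth r) (depth m + depth r).
Proof.
move=> nW r lerm.
(* The induction also carries the amplitude, bounded by the length of the outermost run and equal to
   0 for the empty word. *)
suff [e exc] : height W (depth m - depth r) = height W (depth m + depth r) /\
  forall p, (depth m - depth r <= p <= depth m + depth r)%N ->
  let dh := if up_level r then height W p - height W (depth m - depth r)
            else height W (depth m - depth r) - height W p in
  0 <= dh <= (if r is r'.+1 then l r' else 0)%:Z.
  by split=> // p /exc; case: (up_level r) => /=; lia.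
elim: r lerm => [|r IHr] ltrm.
  rewrite depth0 subn0 addn0; split=> // p Hp.
  have -> : p = depth m by lia.
  by rewrite /= subrr; case: ifP.
have [e exc] := IHr (ltnW ltrm); have [WL WR] := nW r ltrm.
have le1 := depth_le ltrm; have dS := depthS r.
set D := depth m in e exc WL WR le1 *.
have HL c : (c <= l r)%N -> height W (D - depth r.+1 + c) =
  height W (D - depth r.+1) + (if up_level r.+1 then c%:Z else - c%:Z).
  by move=> lec; apply: height_run => q Hq; apply: WL; lia.
have HR c : (c <= l r)%N -> height W (D + depth r + c) =
  height W (D + depth r) + (if ~~ up_level r.+1 then c%:Z else - c%:Z).
  by move=> lec; apply: height_run => q Hq; apply: WR; lia.
have HL1 := HL (l r) (leqnn _); have HR1 := HR (l r) (leqnn _).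
have eL : (D - depth r.+1 + l r = D - depth r)%N by lia.
have eR : (D + depth r + l r = D + depth r.+1)%N by lia.
rewrite eL in HL1; rewrite eR in HR1; rewrite up_levelS in HL HR HL1 HR1 *.
split; first by move: HL1 HR1; case: (up_level r) => /=; lia.
move=> p Hp /=.
have lel : ((if r is r'.+1 then l r' else 0) <= l r)%N.
  by case: (r) ltrm => // r' lt; apply: l_le; lia.
case: (ltnP p (D - depth r)) => [ltp|lep].
  have := HL (p - (D - depth r.+1))%N; rewrite subnKC; last lia.
  move=> /(_ ltac:(lia)) ->; case: (up_level r) => /=; lia.
case: (ltnP (D + depth r) p) => [ltp|gep].
  have := HR (p - (D + depth r))%N; rewrite subnKC; last lia.
  move=> /(_ ltac:(lia)) ->; move: HL1 HR1 e; case: (up_level r) => /=; lia.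
have := exc p; rewrite lep gep => /(_ isT) /=.
by move: HL1 HR1 e; case: (up_level r) => /=; lia.
Qed.

End Nested.

(** * Nested words *)

Lemma big_nat_trunc (R : nmodType) (f : nat -> R) s N : (s <= N)%N ->
  (forall u, (s <= u)%N -> f u = 0) ->
  \sum_(0 <= u < N) f u = \sum_(0 <= u < s) f u.
Proof.
move=> lesN f0; rewrite (big_cat_nat (leq0n s) lesN) /= [X in _ + X]big1_seq ?addr0 // => u.
by rewrite mem_index_iota => /andP[_ /andP[/f0]].
Qed.

Section NestedWords.
Variables (R : comNzRingType) (theta : nat -> R) (L n m : nat).
Variables (l : nat -> nat) (W : nat -> bool).
Hypothesis theta2 : forall x, theta x * theta x = 0.
Hypothesis l_le : forall r q, (r <= q < m)%N -> (l r <= l q)%N.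
Hypothesis W_nested : nested_word m l W.
Hypothesis n_eq : n = (2 * depth l m)%N.
Variable F : nat -> 'M[R]_n.+1.
Let A := letter_mx R W n true.
Let B := letter_mx R W n false.
Let S := flow_words A B F.
Hypothesis F_bal : forall x, (x <= L)%N -> balanced_mx W (F x).
Hypothesis F_diag : forall x i, (x <= L)%N -> F x i i = 1.
Hypothesis F_eq : forall x, (x <= L)%N ->
  F x = 1 + A * (\sum_(x <= y < L) theta y *: F y) * B * F x
          + B * (\sum_(0 <= y < x) theta y *: F y) * A * F x.

(** The sum of the products of e_(b_i)(theta) over (b_1, ..., b_r) of total [s] with b_1 + ... + b_n
    at most [depth l n] for n < r; [j] is the last entry b_r. *)
Fixpoint tuple_sum (r s : nat) : R :=
  if r is r'.+1 then
    \sum_(0 <= j < s.+1) elem_sym theta L j *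
      (if (s - j <= depth l r')%N then tuple_sum r' (s - j) else 0)
  else (s == 0%N)%:R.

(** [top r] is the cut at which the outer runs of the r-th interior word must be selected. The side
    alternates with the level, so [top r.+1] equals [bot r]. *)
Let top r := if up_level m r then L else 0%N.
Let bot r := if up_level m r then 0%N else L.

(** Selecting [q.*2] letters of the r-th interior word leaves [depth l r - q] pairs of glued edges,
    whence the total in [tuple_sum]. *)
Let bottom_value r := forall q (i j : 'I_n.+1),
  i = (depth l m - depth l r)%N :> nat -> j = (depth l m + depth l r)%N :> nat ->
  S q.*2 (bot r) i j =
  if (q <= depth l r)%N then tuple_sum r (depth l r - q) else 0.

Lemma nested_words_top r u (i j : 'I_n.+1) : (r < m)%N -> bottom_value r ->
  i = (depth l m - depth l r.+1)%N :> nat ->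
  j = (depth l m + depth l r.+1)%N :> nat ->
  S u.*2 (top r.+1) i j = if (u < l r)%N then 0 else
  if (u - l r <= depth l r)%N then tuple_sum r (depth l r - (u - l r)) else 0.
Proof.
move=> ltrm Hr ei ej.
have ltm : (depth l r.+1 <= depth l m)%N by apply: depth_le.
have dS := depthS l r.
have lti : (depth l m - depth l r < n.+1)%N by lia.
have ltj : (depth l m + depth l r < n.+1)%N by lia.
have [WL WR] := W_nested ltrm.
rewrite (@words_top_iter _ _ _ _ _ _ F_eq _ (l r) _ i j (Ordinal lti)
  (Ordinal ltj)) //=; try lia.
- case: ltnP => // _.
  have -> : (if up_level m r.+1 then L else 0%N) = bot r.
    by rewrite /bot up_levelS; case: up_level.
  exact: Hr.
- by move=> p Hp; apply: WL; lia.
- by move=> p Hp; apply: WR; lia.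
Qed.

(** The expansion from [bot r.+1] to [top r.+1] produces the last entry of the tuple; at [top r.+1]
    the runs are stripped and the previous level applies. *)
Lemma nested_words r : (r <= m)%N -> bottom_value r.
Proof.
elim: r => [|r IHr] lerm q i j ei ej.
  have -> : j = i by apply: val_inj; rewrite /= ei ej depth0 subn0 addn0.
  rewrite (words_diag F_bal F_diag); last by rewrite /bot; case: ifP.
  by rewrite depth0 double_eq0 /=; case: q.
have exc := nested_excursion l_le W_nested lerm.
rewrite -ei -ej in exc.
have dS := depthS l r.
have topE u := nested_words_top u lerm (IHr (ltnW lerm)) ei ej.
(* The number of terms has to exceed [L] for the expansion and [depth l r.+1 - q] for the truncation
   below. *)
rewrite /bot (words_expansion theta2 F_bal F_eq q.*2 exc
  (N := L.+1 + (depth l r.+1 - q).+1)); last lia.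
case: leqP => [leqd|ltdq].
  rewrite (@big_nat_trunc _ _ (depth l r.+1 - q).+1); [|lia|].
    apply: eq_big_nat => u Hu; congr (_ * _).
    rewrite -doubleD -/(top _) topE; case: ltnP => [lt|le].
      by case: ifP => //; lia.
    case: leqP => [le'|lt']; case: leqP => [le''|lt''] //; try lia.
    by congr (tuple_sum r _); lia.
  move=> u leu; rewrite -doubleD -/(top _) topE.
  by case: ltnP => _; [|case: leqP => ?; [lia|]]; rewrite mulr0.
rewrite big1_seq // => u _; rewrite -doubleD -/(top _) topE.
by case: ltnP => _; [|case: leqP => ?; [lia|]]; rewrite mulr0.
Qed.

(** The root receives a label besides the non-root vertices, so the total is one more than the
    number of edges. *)
Lemma sum_nested_words r (i j : 'I_n.+1) : m = r.+1 -> (0 < l r)%N ->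
  i = 0%N :> nat -> j = n :> nat ->
  \sum_(0 <= x < L) theta x * F x i j = tuple_sum m (depth l m).+1.
Proof.
move=> em lr_gt0 ei ej.
have ltrm : (r < m)%N by rewrite em.
have exc := nested_excursion l_le W_nested (leqnn m).
have ei' : i = (depth l m - depth l r.+1)%N :> nat by rewrite em in ei *; lia.
have ej' : j = (depth l m + depth l r.+1)%N :> nat by rewrite -em; lia.
rewrite -em in ei' ej'; rewrite -ei' -ej' /up_level eqxx in exc.
have dS := depthS l r.
have dm : depth l m = (depth l r + l r)%N by rewrite em.
have eL : L = top r.+1 by rewrite /top /up_level em eqxx.
have := fun u => @nested_words_top r u i j ltrm (nested_words (ltnW ltrm)).
rewrite -eL -em => topE; have {}topE u := topE u ei' ej'.
rewrite (sum_words_expansion theta2 F_bal F_eq exc (N := L + (depth l m).+1)); last lia.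
(* The term j = 0 violates the bound, since all the labels would lie in the earlier sets; the others
   correspond to the shifted indices of [sum_words_expansion]. *)
rewrite [in RHS]em [tuple_sum r.+1 _]/= big_nat_recl // subn0.
rewrite [X in _ = _ * X + _]ifF; last by lia.
rewrite mulr0 add0r (@big_nat_trunc _ _ (depth l m).+1); [|lia|]; last first.
  move=> u leu; rewrite topE; case: ltnP => // _; first by rewrite mulr0.
  by rewrite ifF ?mulr0 //; lia.
rewrite -[r.+1]em; apply: eq_big_nat => u Hu; congr (_ * _); rewrite topE subSS.
case: ltnP => [lt|le]; first by rewrite ifF //; lia.
by rewrite !ifT; [congr (tuple_sum r _)| |]; lia.
Qed.

End NestedWords.

(** * Tuples of disjoint sets and square-zero weights *)

Section SetTuples.
Variables (R : comNzRingType) (theta : nat -> R) (L : nat).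
Hypothesis theta2 : forall x, theta x * theta x = 0.

Lemma elem_sym_sets j :
  elem_sym theta L j = \sum_(T : {set 'I_L} | #|T| == j) \prod_(i in T) theta i.
Proof.
rewrite /elem_sym big_mkord; under eq_bigr => i _ do rewrite addrC.
rewrite bigA_distr coef_sum [RHS]big_mkcond; apply: eq_bigr => T _.
rewrite -big_mkcond /=.
have -> : \prod_(i in T) (theta i *: 'X : {poly R}) = (\prod_(i in T) theta i) *: 'X^#|T|.
  by rewrite scaler_prod prodr_const.
by rewrite coefZ coefXn eq_sym; case: eqP => _; rewrite ?mulr1 ?mulr0.
Qed.

Definition ffun_rcons (T : Type) r (g : {ffun 'I_r -> T}) (t : T) :
  {ffun 'I_r.+1 -> T} := [ffun i => oapp g t (unlift ord_max i)].

Lemma ffun_rcons_max (T : Type) r (g : {ffun 'I_r -> T}) t :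
  ffun_rcons g t ord_max = t.
Proof. by rewrite ffunE unlift_none. Qed.

Lemma ffun_rcons_widen (T : Type) r (g : {ffun 'I_r -> T}) t i :
  ffun_rcons g t (widen_ord (leqnSn r) i) = g i.
Proof.
rewrite ffunE; have -> : widen_ord (leqnSn r) i = lift ord_max i.
  by apply: val_inj; rewrite /= /bump leqNgt ltn_ord.
by rewrite liftK.
Qed.

Lemma sum_ffun_rcons (T : finType) r (P : pred {ffun 'I_r.+1 -> T}) E :
  \sum_(f | P f) E f =
  \sum_t \sum_(g | P (ffun_rcons g t)) E (ffun_rcons g t) :> R.
Proof.
rewrite pair_big_dep /= (reindex (fun p => ffun_rcons p.2 p.1)) //=.
exists (fun f => (f ord_max, [ffun i => f (widen_ord (leqnSn r) i)])).
  move=> [t g] _ /=; rewrite ffun_rcons_max; congr (_, _).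
  by apply/ffunP => i; rewrite ffunE ffun_rcons_widen.
move=> f _ /=; apply/ffunP => i.
case: (unliftP ord_max i) => [j ->|->]; last by rewrite ffun_rcons_max.
have -> : lift ord_max j = widen_ord (leqnSn r) j.
  by apply: val_inj; rewrite /= /bump leqNgt ltn_ord.
by rewrite ffun_rcons_widen ffunE.
Qed.

Variable l : nat -> nat.

Definition bounded_tuple r (s : nat) (f : {ffun 'I_r -> {set 'I_L}}) :=
  (\sum_(j < r) #|f j| == s)%N &&
  [forall n : 'I_r, (\sum_(j < r | (j < n)%N) #|f j| <= depth l n)%N].

(** The bounds for n < r concern [g] alone and the new one, at n = r, bounds the whole of [g]: this
    is the recursion of [tuple_sum]. *)
Lemma bounded_rcons r s (g : {ffun 'I_r -> {set 'I_L}}) T :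
  bounded_tuple s (ffun_rcons g T) =
  [&& (#|T| <= s)%N, (s - #|T| <= depth l r)%N & bounded_tuple (s - #|T|) g].
Proof.
rewrite /bounded_tuple big_ord_recr /= ffun_rcons_max.
under eq_bigr => i _ do rewrite ffun_rcons_widen.
set G := \sum_(i < r) _.
have -> : (G + #|T| == s)%N = (#|T| <= s)%N && (G == s - #|T|)%N by lia.
rewrite -!andbA; case: (leqP #|T| s) => //= leTs.
have [eG|] := eqVneq G; last by rewrite andbF.
rewrite /=.
have part (n : nat) : (\sum_(j < r.+1 | (j < n)%N) #|ffun_rcons g T j| =
    \sum_(j < r | (j < n)%N) #|g j| + (if r < n then #|T| else 0))%N.
  rewrite big_mkcond big_ord_recr /= ffun_rcons_max; congr (_ + _)%N.
  by rewrite [RHS]big_mkcond; apply: eq_bigr => i _; rewrite ffun_rcons_widen.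
apply/forallP/andP => [H|[Hr /forallP H] n].
  split; first have := H ord_max.
    rewrite part ltnn addn0 -eG; congr (_ <= _)%N.
    by apply: eq_bigl => i; rewrite ltn_ord.
  apply/forallP => n; have := H (widen_ord (leqnSn r) n).
  by rewrite part /= [(r < n)%N]ltnNge (ltnW (ltn_ord n)) addn0.
rewrite part [(r < n)%N]ltnNge leq_ord addn0.
have [ltnr|lern] := ltnP n r; first exact: (H (Ordinal ltnr)).
have en : n = r :> nat by apply/eqP; rewrite eqn_leq lern leq_ord.
by rewrite en (eq_bigl xpredT) -/G ?eG // => i; rewrite ltn_ord.
Qed.

(** Each e_j is expanded over the subsets of size [j], giving tuples of sets that may still
    overlap. *)
Lemma tuple_sumE r s : tuple_sum theta L l r s =
  \sum_(f : {ffun 'I_r -> {set 'I_L}} | bounded_tuple s f)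
     \prod_i \prod_(x in f i) theta x.
Proof.
elim: r s => [|r IHr] s /=.
  have f0 : {ffun 'I_0 -> {set 'I_L}} := [ffun=> set0].
  have uf (f : {ffun 'I_0 -> {set 'I_L}}) : f = f0 by apply/ffunP => -[].
  have eP (f : {ffun 'I_0 -> {set 'I_L}}) : bounded_tuple s f = (s == 0%N).
    rewrite /bounded_tuple.
    rewrite big_ord0 eq_sym [[forall _, _]](_ : _ = true) ?andbT //.
    by apply/forallP => -[].
  case: s eP => [|s] eP /=; last by rewrite big_pred0.
  rewrite (big_pred1 f0) ?big_ord0 // => f.
  by rewrite eP /= (uf f) !eqxx.
rewrite sum_ffun_rcons.
under [RHS]eq_bigr => T _.
  under eq_bigl => g do rewrite bounded_rcons.
  under eq_bigr => g _.
    rewrite big_ord_recr /= ffun_rcons_max.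
    under eq_bigr => i _ do rewrite ffun_rcons_widen.
    over.
  over.
transitivity (\sum_(T : {set 'I_L} | (#|T| < s.+1)%N)
  (\prod_(x in T) theta x) *
  (if (s - #|T| <= depth l r)%N then tuple_sum theta L l r (s - #|T|) else 0)).
  rewrite big_mkord (partition_big (fun T : {set 'I_L} => inord #|T| : 'I_s.+1) xpredT) //=.
  apply: eq_bigr => j _; rewrite elem_sym_sets mulr_suml.
  apply: eq_big => [T|T /eqP-> //].
  have [lt|ge] := ltnP; first by rewrite -val_eqE /= inordK.
  by apply/eqP => e; move: ge; rewrite e leqNgt ltn_ord.
rewrite [LHS]big_mkcond; apply: eq_bigr => T _; rewrite ltnS.
case: leqP => _ /=; last by rewrite big_pred0.
case: ifP => _ /=; last by rewrite mulr0 big_pred0.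
by rewrite IHr mulr_sumr; apply: eq_bigr => g _; rewrite mulrC.
Qed.


Lemma prod_nonuniq (s : seq nat) : ~~ uniq s -> \prod_(x <- s) theta x = 0.
Proof.
elim: s => [|x s IHs] //=; rewrite big_cons negb_and negbK => /orP[xs|/IHs->].
  by rewrite (perm_big _ (perm_to_rem xs)) big_cons mulrA theta2 mul0r.
by rewrite mulr0.
Qed.

(** A common element of two sets produces a square [theta x * theta x]; disjoint sets of total size
    [L] cover everything, so each weight occurs once. *)
Lemma prod_family_set r (f : {ffun 'I_r -> {set 'I_L}}) :
  (\sum_i #|f i| = L)%N ->
  \prod_i \prod_(x in f i) theta x =
  if [forall i, forall j, (i != j) ==> [disjoint f i & f j]]
  then \prod_(x < L) theta x else 0.
Proof.
move=> sf; case: ifP => [/forallP dis|].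
  have dis' i j : i != j -> [disjoint f i & f j].
    by have /forallP/(_ j)/implyP := dis i.
  have bE : \bigcup_(j < r) f j = setT.
    apply/eqP; rewrite eqEcard subsetT cardsT card_ord -{1}sf.
    by rewrite -sum1_card (partition_disjoint_bigcup _ _ dis') /= leq_sum // => i _; rewrite sum1_card.
  rewrite -(partition_disjoint_bigcup _ _ dis') bE.
  by apply: eq_bigl => x; rewrite inE.
move=> /negbT; rewrite negb_forall => /existsP[i]; rewrite negb_forall => /existsP[j].
rewrite negb_imply => /andP[nij /pred0Pn[x /andP[xi xj]]].
rewrite (bigD1 i) //= (bigD1 j) 1?eq_sym //= (bigD1 x) //= [X in _ * (X * _)](bigD1 x) //=.
set a := \prod_(_ | _) _; set b := \prod_(_ | _) _; set c := \prod_(_ | _) _.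
have -> : theta x * a * (theta x * b * c) = theta x * theta x * (a * b * c) by ring.
by rewrite theta2 mul0r.
Qed.

End SetTuples.

Lemma tuple_sum_set_tuples (R : comNzRingType) (theta : nat -> R) (m : nat)
    (l : m.-tuple nat) (L := (sumn l).+1) :
  (forall x, theta x * theta x = 0) ->
  tuple_sum theta L (nth 0%N l) m L =
  (\prod_(x < L) theta x) *+ #|set_tuples l|.
Proof.
move=> theta2; rewrite tuple_sumE.
rewrite (eq_bigr (fun f : {ffun 'I_m -> {set 'I_L}} =>
  if [forall i, forall j, (i != j) ==> [disjoint f i & f j]]
  then \prod_(x < L) theta x else 0)); last first.
  by move=> f /andP[/eqP sf _]; exact: prod_family_set.
rewrite -big_mkcondr -sumr_const; apply: eq_bigl => f; rewrite inE /bounded_tuple.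
have dE (n : 'I_m) : depth (nth 0%N l) n = (\sum_(j < m | (j < n)%N) tnth l j)%N.
  rewrite /depth big_mkord (big_ord_widen m (nth 0%N l)) ?(ltnW (ltn_ord n)) //.
  by apply: eq_bigr => i _; rewrite (tnth_nth 0%N).
rewrite [RHS]andbA andbC andbA; congr (_ && _); last first.
  (* At n = 0 the bound concerns an empty sum, in agreement with the condition [1 <= n] in
     [set_tuples]. *)
  apply: eq_forallb => n; rewrite dE; case: (posnP n) => [->|_ //].
  by rewrite big_pred0.
case: (boolP [forall i, _]) => //= /forallP dis.
have dis' i j : i != j -> [disjoint f i & f j].
  by have /forallP/(_ j)/implyP := dis i.
have -> : (\sum_(j < m) #|f j|)%N = #|\bigcup_(j < m) f j|.
  rewrite -sum1_card (partition_disjoint_bigcup _ _ dis') /=.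
  by apply: eq_bigr => i _; rewrite sum1_card.
by rewrite eqEcard subsetT cardsT card_ord eqn_leq -[X in (_ <= X)%N](card_ord L) max_card.
Qed.

Lemma fibers_bijection (m : nat) (l : m.-tuple nat) :
  bijection_between (sequences l) (set_tuples l) (@fibers m l).
Proof.
split.
  move=> a b _ _ /ffunP eab; apply/ffunP => i.
  by have /setP/(_ i) := eab (a i); rewrite !ffunE !inE eqxx => /esym/eqP.
have part (a : {ffun 'I_(sumn l).+1 -> 'I_m}) (n : 'I_m) :
    #|[set i | (a i < n)%N]| = (\sum_(j < m | (j < n)%N) #|fibers a j|)%N.
  rewrite -sum1_card (partition_big a (fun j => (j < n)%N)) /=; last first.
    by move=> i; rewrite inE.
  apply: eq_bigr => j ltj; rewrite -sum1_card; apply: eq_bigl => i.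
  by rewrite ffunE !inE; case: eqP => [->|]; rewrite ?andbF ?andbT ?ltj.
apply/setP => f; apply/imsetP/idP => [[a]|].
  rewrite !inE => /forallP aP ->; apply/and3P; split.
  - apply/forallP => i; apply/forallP => j; apply/implyP => nij.
    apply/pred0P => x /=; rewrite !ffunE !inE; apply/andP => -[/eqP-> /eqP eij].
    by rewrite eij eqxx in nij.
  - apply/eqP/setP => x; rewrite inE; apply/bigcupP; exists (a x) => //.
    by rewrite ffunE inE.
  - by apply/forallP => n; have := aP n; rewrite part.
rewrite inE => /and3P[/forallP dis /eqP cov bnd].
have ex x : exists j, x \in f j.
  by have /bigcupP[j _ xj] : x \in \bigcup_j f j by [rewrite cov]; exists j.
pose a := [ffun x => xchoose (ex x)].
have fE : f = fibers a.
  apply/ffunP => j; apply/setP => x; rewrite !ffunE inE ffunE.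
  have xc := xchooseP (ex x); apply/idP/eqP => [xj|<- //].
  apply/eqP; apply: contraT => ne; have /forallP/(_ j) := dis (xchoose (ex x)).
  by rewrite ne /= => /pred0P/(_ x); rewrite /= xc xj.
exists a => //; rewrite inE; apply/forallP => n; have /forallP/(_ n) := bnd.
by rewrite part fE.
Qed.

(** * Independent square-zero weights from iterated dual numbers *)

Definition dual (R : Type) : Type := (R * R)%type.

Section Dual.
Variable R : comNzRingType.

HB.instance Definition _ := GRing.Zmodule.on (dual R).

Definition dual_one : dual R := (1, 0).
(** The pair (a, b) stands for a + b e with e^2 = 0. *)
Definition dual_mul (u v : dual R) : dual R :=
  (u.1 * v.1, u.1 * v.2 + u.2 * v.1).

Lemma dual_mulA : associative dual_mul.
Proof. by move=> u v w; rewrite /dual_mul /=; congr (_, _); ring. Qed.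

Lemma dual_mulC : commutative dual_mul.
Proof. by move=> u v; rewrite /dual_mul /=; congr (_, _); ring. Qed.

Lemma dual_mul1 : left_id dual_one dual_mul.
Proof. by move=> [a b]; rewrite /dual_mul /=; congr (_, _); ring. Qed.

Lemma dual_addE (u v : dual R) : u + v = (u.1 + v.1, u.2 + v.2).
Proof. by []. Qed.

Lemma dual_mulDl : left_distributive dual_mul +%R.
Proof.
by move=> u v w; rewrite /dual_mul !dual_addE /=; congr (_, _); ring.
Qed.

Lemma dual_one_neq0 : dual_one != 0.
Proof. by rewrite /dual_one xpair_eqE oner_eq0. Qed.

HB.instance Definition _ := GRing.Zmodule_isComNzRing.Build (dual R)
  dual_mulA dual_mulC dual_mul1 dual_mulDl dual_one_neq0.

End Dual.

(** Starting from [int], each level of dual numbers adjoins a new weight e and embeds the old ones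
    as constants. The full product becomes the old product times e, so no positive multiple of it
    vanishes. *)
Lemma exists_nilpotents (L : nat) :
  exists (R : comNzRingType) (theta : nat -> R),
    (forall x, theta x * theta x = 0) /\
    (forall k, (\prod_(x < L) theta x) *+ k = 0 -> k = 0%N).
Proof.
elim: L => [|L [R [theta [theta2 indep]]]].
  exists int, (fun=> 0); split=> [x|k]; first by rewrite mulr0.
  by rewrite big_ord0 => /eqP; rewrite pnatr_eq0 => /eqP.
pose theta' x : dual R := if (x < L)%N then (theta x, 0) else (0, 1).
exists (dual R : comNzRingType), theta'; split=> [x|k].
  rewrite /theta' /GRing.mul /= /dual_mul; case: ifP => _ /=.
    by rewrite theta2 mulr0 mul0r addr0.
  by rewrite !mul0r mulr0 addr0.
have prodE n : (n <= L)%N ->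
    \prod_(x < n) theta' x = ((\prod_(x < n) theta x, 0) : dual R).
  elim: n => [|n IHn] leL; first by rewrite !big_ord0.
  rewrite !big_ord_recr /= IHn ?(ltnW leL) // /theta' leL.
  by rewrite {1}/GRing.mul /= /dual_mul /= mulr0 mul0r addr0.
rewrite big_ord_recr /= prodE // /theta' ltnn {1}/GRing.mul /= /dual_mul /=.
rewrite mulr0 mulr1 mul0r addr0 => e; apply: indep.
have E (b : R) n : ((0, b) : dual R) *+ n = (0, b *+ n).
  by elim: n => [|n IHn] //; rewrite !mulrS IHn dual_addE /= addr0.
by move: e; rewrite E => -[].
Qed.

(** * Generating function of labelled trees *)

(* [Node y t1 t2]: the first child of the root has label [y] and subtree [t1], and
   [t2] is the rest of the tree, hanging from the same root, whose label is kept
   outside. *)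
Inductive ltree := Leaf | Node of nat & ltree & ltree.

Fixpoint eq_ltree (s t : ltree) : bool :=
  match s, t with
  | Leaf, Leaf => true
  | Node x s1 s2, Node y t1 t2 => [&& x == y, eq_ltree s1 t1 & eq_ltree s2 t2]
  | _, _ => false
  end.

Lemma eq_ltreeP : Equality.axiom eq_ltree.
Proof.
elim=> [|x s1 IH1 s2 IH2] [|y t1 t2]; try by constructor.
apply: (iffP and3P) => [[/eqP-> /IH1-> /IH2->] //|[-> <- <-]].
by split=> //; [apply/IH1|apply/IH2].
Qed.

HB.instance Definition _ := hasDecEq.Build ltree eq_ltreeP.

Fixpoint tsize t := if t is Node _ t1 t2 then (tsize t1 + tsize t2).+1 else 0%N.

Fixpoint labels t := if t is Node y t1 t2 then y :: labels t1 ++ labels t2 else [::].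

Lemma size_labels t : size (labels t) = tsize t.
Proof. by elim: t => //= y t1 IH1 t2 IH2; rewrite size_cat IH1 IH2. Qed.

Section Trees.
Variable L : nat.

(* Letting an upper neighbour carry the label [x] itself fits the reading of [x] as
   a cut, and changes nothing once [theta x] is a factor. *)
Definition side (c : bool) (x y : nat) := if c then (x <= y)%N else (y < x)%N.

(** The edge to the first child opens with [c] and closes at the position dictated by the size of
    its subtree; the default [c] of [nth] makes the test fail when that position lies outside the
    word. *)
Fixpoint fits (w : seq bool) (x : nat) (t : ltree) : bool :=
  match t, w with
  | Leaf, [::] => true
  | Node y t1 t2, c :: w' =>
      [&& nth c w' (tsize t1).*2 == ~~ c, (y < L)%N, side c x y,
          fits (take (tsize t1).*2 w') y t1 & fits (drop (tsize t1).*2.+1 w') x t2]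
  | _, _ => false
  end.

(** [n] is fuel; [s] consists of the position closing the first edge and the label of the first
    child. *)
Fixpoint trees (n : nat) (w : seq bool) (x : nat) : seq ltree :=
  match w, n with
  | [::], _ => [:: Leaf]
  | c :: w', n'.+1 =>
      [seq Node s.2 t.1 t.2
         | s <- [seq (i, y) | i <- [seq i <- iota 0 (size w') | nth c w' i == ~~ c],
                              y <- [seq y <- iota 0 L | side c x y]],
           t <- [seq (t1, t2) | t1 <- trees n' (take s.1 w') s.2,
                                t2 <- trees n' (drop s.1.+1 w') x]]
  | _, _ => [::]
  end.

Lemma fits_size w x t : fits w x t -> size w = (tsize t).*2.
Proof.
elim: t w x => [|y t1 IH1 t2 IH2] [|c w] //= x.
move=> /and5P[/eqP Hc _ _ /IH1 e1 /IH2 e2].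
have lt : ((tsize t1).*2 < size w)%N.
  by rewrite ltnNge; apply/negP => /(nth_default c) e; move: Hc; rewrite e; case: (c).
move: e1 e2; rewrite size_take size_drop lt; lia.
Qed.

Lemma mem_trees n w x t : (size w <= n)%N -> (t \in trees n w x) = fits w x t.
Proof.
elim: n w x t => [|n IHn] [|c w] x [|y t1 t2] //= ltwn.
  by apply/negbTE/negP => /allpairsPdep[s [t [_ _]]].
have st i : (size (take i w) <= n)%N by rewrite size_take; case: ifP; lia.
have sd i : (size (drop i w) <= n)%N by rewrite size_drop; lia.
apply/allpairsPdep/idP => [[[i y'] [[t1' t2'] [+ + [-> -> ->]]]]|].
  move=> /allpairsPdep[i' [y'' [Hi Hy [-> ->]]]] /allpairsPdep[s1 [s2 [H1 H2 [-> ->]]]].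
  rewrite /= in H1 H2; rewrite IHn // in H1; rewrite IHn // in H2.
  move: Hi Hy; rewrite !mem_filter !mem_iota => /andP[Hc Hi] /andP[Hs Hy].
  have := fits_size H1; rewrite size_take (_ : (i' < size w)%N) // => <-.
  by rewrite Hc Hs H1 H2 andbT; lia.
move=> /and5P[Hc lty Hs H1 H2].
have lt : ((tsize t1).*2 < size w)%N.
  rewrite ltnNge; apply/negP => /(nth_default c) e; move: Hc; rewrite e; by case: (c).
exists ((tsize t1).*2, y), (t1, t2); split=> //; apply/allpairsPdep.
  by exists (tsize t1).*2, y; rewrite !mem_filter !mem_iota Hc Hs; split=> //; lia.
by exists t1, t2; rewrite /= !IHn.
Qed.

Lemma trees_uniq n w x : (size w <= n)%N -> uniq (trees n w x).
Proof.
elim: n w x => [|n IHn] [|c w] x //= ltwn.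
have st i : (size (take i w) <= n)%N by rewrite size_take; case: ifP; lia.
have sd i : (size (drop i w) <= n)%N by rewrite size_drop; lia.
apply: allpairs_uniq_dep => [|[i y] _|].
- by apply: allpairs_uniq; rewrite ?filter_uniq ?iota_uniq // => -[? ?] [? ?] _ _ [-> ->].
- apply: allpairs_uniq; rewrite ?IHn // => -[? ?] [? ?] _ _ [-> ->] //.
move=> p1 p2 /allpairsPdep[[i y] [[t1 t2] [Hi Ht ->]]].
move=> /allpairsPdep[[i' y'] [[t1' t2'] [Hi' Ht' ->]]] /= [ey et1 et2].
(* The closing position can be recovered from the size of the first subtree, so a tree arises from
   one position only. *)
have szE j z s1 s2 : (j, z) \in [seq (i, y) | i <- [seq i <- iota 0 (size w) | nth c w i == ~~ c],
      y <- [seq y <- iota 0 L | side c x y]] ->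
    (s1, s2) \in [seq (t1, t2) | t1 <- trees n (take j w) z, t2 <- trees n (drop j.+1 w) x] ->
    j = (tsize s1).*2.
  move=> /allpairsPdep[j' [_ [Hj _ [ej _]]]] /allpairsPdep[s1' [_ [Hs _ [es _]]]].
  move: Hs; rewrite -es mem_trees // => /fits_size <-.
  by move: Hj; rewrite mem_filter mem_iota -ej => /andP[_ Hj]; rewrite size_take; case: ifP => //; lia.
have ei : i = i' by rewrite (szE _ _ _ _ Hi Ht) (szE _ _ _ _ Hi' Ht') et1.
by subst.
Qed.

Variables (R : comNzRingType) (theta : nat -> R).

Definition weight t := \prod_(y <- labels t) theta y.

Definition tree_sum n w x := \sum_(t <- trees n w x) weight t.

Lemma tree_sum_cons n c w x :
  tree_sum n.+1 (c :: w) x =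
  \sum_(0 <= i < size w | nth c w i == ~~ c)
     (\sum_(0 <= y < L | side c x y) theta y * tree_sum n (take i w) y) *
     tree_sum n (drop i.+1 w) x.
Proof.
rewrite /tree_sum /= big_allpairs_dep /= big_allpairs_dep /=.
rewrite big_filter /index_iota subn0; apply: eq_bigr => i _.
rewrite big_filter mulr_suml subn0; apply: eq_bigr => y _.
rewrite big_allpairs_dep /= -mulrA mulr_suml mulr_sumr; apply: eq_bigr => t1 _.
rewrite mulr_sumr mulr_sumr; apply: eq_bigr => t2 _.
by rewrite /weight /= big_cons big_cat.
Qed.

Lemma tree_sum_fuel n n' w x : (size w <= n)%N -> (size w <= n')%N ->
  tree_sum n w x = tree_sum n' w x.
Proof.
elim: n n' w x => [|n IHn] [|n'] [|c w] x //= ltn ltn'.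
rewrite !tree_sum_cons; apply: eq_bigr => i _; congr (_ * _).
  by apply: eq_bigr => y _; congr (_ * _); apply: IHn; rewrite size_take; case: ifP; lia.
by apply: IHn; rewrite size_drop; lia.
Qed.

(** Every edge of a tree consumes one letter of each kind. *)
Lemma tree_sum_unbalanced n w x :
  count_mem true w != count_mem false w -> tree_sum n w x = 0.
Proof.
elim: n w x => [|n IHn] [|c w] x //= unb.
  by rewrite /tree_sum big_nil.
rewrite tree_sum_cons big1_seq // => i; rewrite mem_index_iota => /andP[/eqP Hc Hi].
have [eT|/IHn z] := eqVneq (count_mem true (drop i.+1 w)) (count_mem false (drop i.+1 w)); last first.
  by rewrite z mulr0.
rewrite big1 ?mul0r // => y _; rewrite IHn ?mulr0 //.
apply: contraNneq unb => eT'; move: Hi; rewrite -[in count_mem true w](cat_take_drop i w).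
rewrite -[in count_mem false w](cat_take_drop i w) => /andP[_ lti].
rewrite (drop_nth c lti) Hc !count_cat /= eT eT'.
by case: (c) => /=; lia.
Qed.

End Trees.

(** * The matrix of tree sums satisfies the noncrossing equation *)

Section TreeMatrix.
Variables (R : comNzRingType) (theta : nat -> R) (L n : nat) (w : seq bool).
Hypothesis size_w : size w = n.
Let W := nth false w.

Definition subword (i j : nat) := take (j - i) (drop i w).

Definition tree_mx (x : nat) : 'M[R]_n.+1 :=
  \matrix_(i, j) if (i <= j)%N then
    tree_sum L theta (j - i) (subword i j) x else 0.

Lemma size_subword i j : (j <= n)%N -> size (subword i j) = (j - i)%N.
Proof. by move=> lej; rewrite size_takel // size_drop size_w leq_sub2r. Qed.

Lemma subword_cons i j : (i < j)%N -> (j <= n)%N ->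
  subword i j = W i :: subword i.+1 j.
Proof.
move=> ltij lej; rewrite /subword (drop_nth false) ?size_w; last by lia.
by have -> : (j - i = (j - i.+1).+1)%N by lia.
Qed.

Lemma take_subword i j k : (i + k <= j)%N -> take k (subword i j) = subword i (i + k).
Proof.
by move=> le; rewrite /subword addKn -take_min (minn_idPl _) //; lia.
Qed.

Lemma drop_subword i j k : drop k (subword i j) = subword (i + k) j.
Proof.
rewrite /subword; have [le|lt] := leqP k (j - i).
  by rewrite -{1}(subnK le) -take_drop drop_drop subnDA addnC.
rewrite drop_oversize; last by rewrite size_take; case: ifP; lia.
by rewrite (_ : (j - (i + k))%N = 0%N) ?take0 //; lia.
Qed.

Lemma nth_subword i j k c : (i + k < j)%N -> (j <= n)%N -> nth c (subword i j) k = W (i + k).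
Proof.
move=> lt lej; rewrite nth_take; last by lia.
by rewrite nth_drop (set_nth_default false) // size_w; lia.
Qed.

Lemma tree_mx_diag x i : tree_mx x i i = 1.
Proof.
rewrite mxE leqnn /subword subnn take0 /tree_sum /= big_seq1.
by rewrite /weight big_nil.
Qed.

Lemma height_count i k : (i + k <= n)%N ->
  height W (i + k) + (count_mem false (subword i (i + k)))%:Z =
  height W i + (count_mem true (subword i (i + k)))%:Z.
Proof.
elim: k => [|k IHk] le; first by rewrite addn0 /subword subnn take0 /= !addr0.
have := IHk ltac:(lia); rewrite /subword !addKn (take_nth false); last first.
  by rewrite size_drop size_w; lia.
rewrite -cats1 !count_cat nth_drop addnS /= -/(W (i + k)).
by case: (W (i + k)) => /=; lia.
Qed.

Lemma tree_mx_balanced x : balanced_mx W (tree_mx x).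
Proof.
move=> i j; rewrite mxE; case: leqP => //= leij nh.
apply: tree_sum_unbalanced; apply: contraNneq nh => e.
have := @height_count i (j - i); rewrite subnKC // -ltnS ltn_ord => /(_ isT).
by rewrite e => /addIr ->.
Qed.

Lemma letter_mulE c (M : 'M[R]_n.+1) i j :
  (letter_mx R W n c * M) i j =
  if (i < n)%N && (W i == c) then M (inord i.+1) j else 0.
Proof.
rewrite mxE; case: ltnP => [lti|gei] /=.
  rewrite (bigD1 (inord i.+1)) //= big1 ?addr0.
    by rewrite mxE inordK // eqxx; case: eqP => _; rewrite ?mul1r ?mul0r.
  move=> p; rewrite -val_eqE /= inordK // mxE => /negPf->.
  by rewrite mul0r.
rewrite big1 // => p _; rewrite mxE; case: eqP => [e|_]; last by rewrite mul0r.
by have := ltn_ord p; lia.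
Qed.

(** The four factors are the opening letter, the subtree of the first child, the closing letter and
    the rest of the tree; the sum over intermediate indices is the sum over the closing position in
    [tree_sum_cons]. *)
Lemma tree_mx_arch c x i j (D := \sum_(0 <= y < L | side c x y) theta y *: tree_mx y) :
  (letter_mx R W n c * D * letter_mx R W n (~~ c) * tree_mx x) i j =
  if (i < j)%N && (W i == c) then
    \sum_(0 <= k < j - i.+1 | nth c (subword i.+1 j) k == ~~ c)
     (\sum_(0 <= y < L | side c x y) theta y *
       tree_sum L theta k (take k (subword i.+1 j)) y) *
     tree_sum L theta (j - i.+1 - k.+1) (drop k.+1 (subword i.+1 j)) x
  else 0.
Proof.
have lejn : (j <= n)%N by rewrite -ltnS.
rewrite -!mulrA letter_mulE; case: (W i == c); rewrite ?andbF // !andbT.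
have Dent p q : D p q = if (p <= q)%N then \sum_(0 <= y < L | side c x y) theta y *
    tree_sum L theta (q - p) (subword p q) y else 0.
  rewrite /D summxE; case: leqP => [le|lt].
    by apply: eq_bigr => y _; rewrite !mxE le.
  by rewrite big1 // => y _; rewrite !mxE leqNgt lt mulr0.
case: ltnP => [ltin|]; last by case: ltnP => //; lia.
have e1 : (inord i.+1 : 'I_n.+1) = i.+1 :> nat by rewrite inordK.
rewrite mxE; under eq_bigr => q _ do rewrite letter_mulE Dent e1.
transitivity (\sum_(q < n.+1 | (i < q < j)%N && (W q == ~~ c))
  (\sum_(0 <= y < L | side c x y) theta y * tree_sum L theta (q - i.+1) (subword i.+1 q) y) *
  tree_sum L theta (j - q.+1) (subword q.+1 j) x).
  rewrite [RHS]big_mkcond; apply: eq_bigr => q _.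
  case: (ltnP i q) => [ltiq|] /=; last by rewrite mul0r.
  case: (ltnP q j) => [ltqj|gejq] /=; last first.
    rewrite (_ : (if _ then _ else _) = 0) ?mulr0 //; case: ifP => // /andP[ltqn _].
    by rewrite mxE inordK // leqNgt ltnS gejq.
  rewrite (leq_trans ltqj lejn); case: eqP => _ /=; last by rewrite mulr0.
  by rewrite mxE inordK ?ltqj //; lia.
case: (ltnP i j) => [ltij|geij]; last first.
  by rewrite big_pred0 // => q; case: andP => //; lia.
(* The closing position [q] lies strictly between [i] and [j]; a shift by [i.+1] makes it a position
   in [subword i.+1 j]. *)
rewrite -(big_mkord (fun q => (i < q < j)%N && (W q == ~~ c)) (fun q =>
  (\sum_(0 <= y < L | side c x y) theta y * tree_sum L theta (q - i.+1) (subword i.+1 q) y) *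
  tree_sum L theta (j - q.+1) (subword q.+1 j) x)).
have lei1 : (i.+1 <= n.+1)%N by lia.
rewrite (big_cat_nat (leq0n i.+1) lei1) /=.
rewrite [X in X + _]big1_seq ?add0r => [|q]; last first.
  by rewrite mem_index_iota; lia.
rewrite (big_cat_nat ltij (leqW lejn)) /=.
rewrite [X in _ + X]big1_seq ?addr0 => [|q]; last first.
  by rewrite mem_index_iota; lia.
rewrite -{1}[i.+1]add0n big_addn big_mkcond [RHS]big_mkcond.
apply: eq_big_nat => k /andP[_ ltk].
rewrite nth_subword //; last by lia.
have -> : (i < k + i.+1 < j)%N by lia.
rewrite /= [(k + i.+1)%N]addnC; case: ifP => // _.
rewrite addKn take_subword ?drop_subword; last by lia.
by rewrite addnS; congr (_ * tree_sum L theta _ _ _); lia.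
Qed.

(** The identity accounts for the empty word. A nonempty word starts with one of the two letters,
    and only the arch term opening with that letter contributes. *)
Lemma tree_mx_eq x : (x <= L)%N ->
  tree_mx x = 1
   + letter_mx R W n true * (\sum_(x <= y < L) theta y *: tree_mx y)
       * letter_mx R W n false * tree_mx x
   + letter_mx R W n false * (\sum_(0 <= y < x) theta y *: tree_mx y)
       * letter_mx R W n true * tree_mx x.
Proof.
move=> lexL.
have -> : \sum_(x <= y < L) theta y *: tree_mx y =
    \sum_(0 <= y < L | side true x y) theta y *: tree_mx y.
  rewrite [RHS](big_cat_nat (n := x)) //= [X in _ = X + _]big1_seq ?add0r.
    rewrite [LHS]big_seq [RHS]big_seq_cond; apply: eq_bigl => y.
    by rewrite mem_index_iota /side; case: (x <= y)%N; rewrite ?andbF ?andbT.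
  by move=> y; rewrite mem_index_iota; lia.
have -> : \sum_(0 <= y < x) theta y *: tree_mx y =
    \sum_(0 <= y < L | side false x y) theta y *: tree_mx y.
  rewrite [RHS](big_cat_nat (n := x)) //= [X in _ = _ + X]big1_seq ?addr0.
    rewrite [LHS]big_seq [RHS]big_seq_cond; apply: eq_bigl => y.
    by rewrite mem_index_iota /side andbb.
  by move=> y; rewrite mem_index_iota /=; lia.
apply/matrixP => i j; rewrite [RHS]mxE [X in _ = X + _]mxE.
rewrite (tree_mx_arch true) (tree_mx_arch false) mxE.
rewrite [X in _ = X + _ + _]mxE; case: (ltngtP i j) => [ltij|gtij|eij].
- have lejn : (j <= n)%N by rewrite -ltnS.
  rewrite (_ : (i == j) = false) ?add0r; last by apply/negbTE; rewrite -val_eqE /= ltn_eqF.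
  rewrite /= (subword_cons ltij lejn).
  have -> : (j - i = (j - i.+1).+1)%N by lia.
  have fuel c : tree_sum L theta (j - i.+1).+1 (c :: subword i.+1 j) x =
     \sum_(0 <= k < j - i.+1 | nth c (subword i.+1 j) k == ~~ c)
     (\sum_(0 <= y < L | side c x y) theta y *
       tree_sum L theta k (take k (subword i.+1 j)) y) *
     tree_sum L theta (j - i.+1 - k.+1) (drop k.+1 (subword i.+1 j)) x.
    rewrite tree_sum_cons size_subword // !big_mkord; apply: eq_bigr => k _.
    congr (_ * _); last by apply: tree_sum_fuel; rewrite ?size_drop size_subword //; lia.
    apply: eq_bigr => y _; congr (_ * _); apply: tree_sum_fuel.
      by rewrite size_takel ?size_subword //; have := ltn_ord k; lia.
    by rewrite size_takel ?size_subword //; have := ltn_ord k; lia.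
  by rewrite fuel; case: (W i); rewrite /= ?addr0 ?add0r.
- by rewrite (_ : (i == j) = false) ?addr0 //; apply/negbTE; rewrite -val_eqE /= gtn_eqF.
have -> : i = j by apply: val_inj.
by rewrite eqxx !addr0 /subword subnn take0 /tree_sum /= big_seq1 /weight big_nil.
Qed.

Lemma tree_mx_corner x (i j : 'I_n.+1) : i = 0%N :> nat -> j = n :> nat ->
  tree_mx x i j = tree_sum L theta (size w) w x.
Proof.
by move=> ei ej; rewrite mxE ei ej /subword subn0 drop0 size_w take_oversize ?size_w.
Qed.

End TreeMatrix.

(** * Contour walks of labelled trees *)

Section Represent.
Local Open Scope nat_scope.

(** [fits] for the part of a fixed word that starts at [o], without the length test, which reappears
    in [fits_atE]. *)
Fixpoint fits_at (L : nat) (W : nat -> bool) (o x : nat) (t : ltree) : bool :=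
  if t is Node y t1 t2 then
    let p := o.+1 + (tsize t1).*2 in
    [&& W p == ~~ W o, y < L, side (W o) x y,
        fits_at L W o.+1 y t1 & fits_at L W p.+1 x t2]
  else true.

Lemma fits_atE L W o w x t :
  (forall i, i < size w -> nth false w i = W (o + i)) ->
  fits L w x t = (size w == (tsize t).*2) && fits_at L W o x t.
Proof.
elim: t o w x => [|y t1 IH1 t2 IH2] o [|c w] x Hw //=.
have Hc : c = W o by have := Hw 0 isT; rewrite addn0.
have Hw' i : i < size w -> nth false w i = W (o.+1 + i).
  by move=> lti; have := Hw i.+1 lti; rewrite addSnnS.
case: (ltnP (tsize t1).*2 (size w)) => [lt|ge]; last first.
  rewrite (nth_default _ ge); have -> : (c == ~~ c) = false by case: (c).
  by apply/esym/negbTE/negP => /andP[]; lia.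
rewrite (set_nth_default false) // Hw' // -Hc.
rewrite (IH1 o.+1) => [|i]; last first.
  by rewrite (size_takel (ltnW lt)) => lti; rewrite nth_take // Hw' //; lia.
rewrite (IH2 (o.+1 + (tsize t1).*2).+1) => [|i]; last first.
  by rewrite size_drop => lti; rewrite nth_drop Hw'; [congr W; lia|lia].
rewrite (size_takel (ltnW lt)) eqxx size_drop /=.
have -> : ((size w).+1 == ((tsize t1 + tsize t2).+1).*2) =
          (size w - (tsize t1).*2.+1 == (tsize t2).*2) by lia.
by case: (size w - _ == _); rewrite ?andbF ?andFb ?andbT //= !andbF.
Qed.

(* The contour walk [f] and the edge matching [s] of the labelled tree [t] with
   root label [x], started at position [o] of the polygon. *)
Fixpoint rep (s f : nat -> nat) (o x : nat) (t : ltree) : bool :=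
  if t is Node y t1 t2 then
    let p := o.+1 + (tsize t1).*2 in
    [&& f o == x, s o == p, s p == o, rep s f o.+1 y t1 & rep s f p.+1 x t2]
  else f o == x.

Implicit Types (s f : nat -> nat) (o x : nat) (t : ltree).

Lemma rep_start s f o x t : rep s f o x t -> f o = x.
Proof. by case: t => [/eqP|y t1 t2 /and5P[/eqP]]. Qed.

Lemma rep_end s f o x t : rep s f o x t -> f (o + (tsize t).*2) = x.
Proof.
elim: t o x => [|y t1 _ t2 IH2] o x /=; first by rewrite addn0 => /eqP.
by move=> /and5P[_ _ _ _ /IH2 <-]; congr f; lia.
Qed.

Variant position_spec o (a b : nat) (p : nat) : Prop :=
  | PositionOpen of p = o
  | PositionLeft of o < p < o.+1 + a
  | PositionClose of p = o.+1 + a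
  | PositionRight of o.+1 + a < p < o + (a + b).+2.

Lemma positionP o a b p : o <= p < o + (a + b).+2 -> position_spec o a b p.
Proof.
move=> Hp; case: (ltngtP p o) => [|lt|->]; [lia| |by constructor].
case: (ltngtP p (o.+1 + a)) => [lt'|gt'|->]; last by constructor.
  by constructor; rewrite lt.
by constructor; lia.
Qed.

Lemma rep_partner s f o x t p : rep s f o x t -> o <= p < o + (tsize t).*2 ->
  [/\ o <= s p < o + (tsize t).*2, s (s p) = p & s p != p].
Proof.
elim: t o x p => [|y t1 IH1 t2 IH2] o x p /=; first by rewrite addn0; lia.
move=> /and5P[_ /eqP so /eqP sp /IH1 r1 /IH2 r2]; rewrite doubleS doubleD.
case/positionP => [->|Hp|->|Hp].
- by rewrite so sp; split=> //; lia.
- have [|H1 -> ->] := r1 p; first lia.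
  by split=> //; lia.
- by rewrite sp so; split=> //; lia.
- have [|H1 -> ->] := r2 p; first lia.
  by split=> //; lia.
Qed.

Lemma rep_noncrossing s f o x t p q : rep s f o x t ->
  o <= p -> q < o + (tsize t).*2 -> p < q -> q < s p -> s q < s p.
Proof.
elim: t o x p q => [|y t1 IH1 t2 IH2] o x p q /=; first by rewrite addn0; lia.
move=> /and5P[_ /eqP so /eqP sp r1 r2]; rewrite doubleS doubleD => leop ltq ltpq.
have : o <= p < o + ((tsize t1).*2 + (tsize t2).*2).+2 by lia.
case/positionP => [ep|Hp|ep|Hp].
- rewrite ep so => ltq'; have [|] := rep_partner r1 (p := q); lia.
- have [|Hsp _ _] := rep_partner r1 (p := p); first lia.
  by move=> ltqs; apply: (IH1 _ _ _ _ r1) => //; lia.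
- by rewrite ep sp; lia.
- by move=> ltqs; apply: (IH2 _ _ _ _ r2) => //; lia.
Qed.

Lemma rep_letter L W s f o x t p : rep s f o x t -> fits_at L W o x t ->
  o <= p < o + (tsize t).*2 -> W (s p) = ~~ W p.
Proof.
elim: t o x p => [|y t1 IH1 t2 IH2] o x p /=; first by rewrite addn0; lia.
move=> /and5P[_ /eqP so /eqP sp r1 r2] /and5P[/eqP Wp _ _ f1 f2].
rewrite doubleS doubleD; case/positionP => [->|Hp|->|Hp].
- by rewrite so Wp.
- by apply: (IH1 _ _ _ r1 f1); clear -Hp; lia.
- by rewrite sp Wp negbK.
- by apply: (IH2 _ _ _ r2 f2); clear -Hp; lia.
Qed.

Lemma rep_glue s f o x t p : rep s f o x t -> o <= p < o + (tsize t).*2 ->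
  f (s p).+1 = f p.
Proof.
elim: t o x p => [|y t1 IH1 t2 IH2] o x p /=; first by rewrite addn0; lia.
move=> /and5P[/eqP fo /eqP so /eqP sp r1 r2].
rewrite doubleS doubleD; case/positionP => [->|Hp|->|Hp].
- by rewrite so fo (rep_start r2).
- by apply: (IH1 _ _ _ r1); clear -Hp; lia.
- by rewrite sp (rep_end r1) (rep_start r1).
- by apply: (IH2 _ _ _ r2); clear -Hp; lia.
Qed.

(** Distinct labels make the weak inequality of [side] strict. The closing edge is the same tree
    edge walked backwards, with the opposite letter. *)
Lemma rep_monotone L W s f o x t p : rep s f o x t -> fits_at L W o x t ->
  uniq (x :: labels t) -> o <= p < o + (tsize t).*2 ->
  if W p then f p < f p.+1 else f p.+1 < f p.
Proof.
elim: t o x p => [|y t1 IH1 t2 IH2] o x p /=; first by rewrite addn0; lia.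
move=> /and5P[/eqP fo /eqP so /eqP sp r1 r2] /and5P[/eqP Wp _ sxy f1 f2].
rewrite inE !mem_cat cat_uniq !negb_or =>
  /and3P[/and3P[nxy nx1 nx2] /andP[ny1 ny2] /and3P[u1 _ u2]].
have u1' : uniq (y :: labels t1) by rewrite /= ny1 u1.
have u2' : uniq (x :: labels t2) by rewrite /= nx2 u2.
rewrite doubleS doubleD; case/positionP => [->|Hp|->|Hp].
- rewrite fo (rep_start r1); move: sxy nxy; rewrite /side; case: (W o) => //.
  by rewrite ltn_neqAle => ->; rewrite andbT.
- by apply: (IH1 _ _ _ r1 f1 u1'); clear -Hp; lia.
- rewrite (rep_end r1) (rep_start r2) Wp; move: sxy nxy; rewrite /side.
  case: (W o) => //= le ne; by rewrite ltn_neqAle ne.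
- by apply: (IH2 _ _ _ r2 f2 u2'); clear -Hp; lia.
Qed.

Lemma rep_image s f o x t p : rep s f o x t -> o <= p <= o + (tsize t).*2 ->
  f p \in x :: labels t.
Proof.
elim: t o x p => [|y t1 IH1 t2 IH2] o x p /=.
  by rewrite addn0 inE => fo Hp; have -> : p = o by lia.
move=> /and5P[/eqP fo _ _ r1 r2]; rewrite doubleS doubleD => Hp.
rewrite !inE mem_cat; case: (ltngtP p o) => [|lt|->]; [lia| |by rewrite fo eqxx].
case: (leqP p (o.+1 + (tsize t1).*2)) => [le|gt].
  have := IH1 _ _ p r1; rewrite le lt => /(_ isT); rewrite inE.
  by case/orP => ->; rewrite ?orbT.
have := IH2 _ _ p r2; rewrite gt => /(_ ltac:(lia)); rewrite inE.
by case/orP => ->; rewrite ?orbT.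
Qed.

Lemma rep_label s f o x t z : rep s f o x t -> z \in x :: labels t ->
  exists2 p, o <= p <= o + (tsize t).*2 & f p = z.
Proof.
elim: t o x => [|y t1 IH1 t2 IH2] o x /=.
  by move=> /eqP fo; rewrite inE => /eqP->; exists o => //; rewrite addn0 leqnn.
move=> /and5P[/eqP fo _ _ r1 r2]; rewrite !inE mem_cat doubleS doubleD.
have H1 : z \in y :: labels t1 -> exists2 p,
    o <= p <= o + ((tsize t1).*2 + (tsize t2).*2).+2 & f p = z.
  by move=> /(IH1 _ _ r1)[p Hp fp]; exists p => //; lia.
have H2 : z \in x :: labels t2 -> exists2 p,
    o <= p <= o + ((tsize t1).*2 + (tsize t2).*2).+2 & f p = z.
  by move=> /(IH2 _ _ r2)[p Hp fp]; exists p => //; lia.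
case/or4P => [zx|zy|z1|z2].
- by apply: H2; rewrite inE zx.
- by apply: H1; rewrite inE zy.
- by apply: H1; rewrite inE z1 orbT.
- by apply: H2; rewrite inE z2 orbT.
Qed.

(** The partner of the first edge reveals the size of the first subtree, and [f] reveals the
    labels. *)
Lemma rep_inj s f o x x' t t' : rep s f o x t -> rep s f o x' t' ->
  tsize t = tsize t' -> x = x' /\ t = t'.
Proof.
move=> r r'; split; first by rewrite -(rep_start r) -(rep_start r').
elim: t t' o x x' r r' H => [|y t1 IH1 t2 IH2] [|y' t1' t2'] o x x' //=.
move=> /and5P[/eqP fo /eqP so _ r1 r2] /and5P[/eqP fo' /eqP so' _ r1' r2'] sz.
have e1 : tsize t1 = tsize t1' by lia.
rewrite -e1 in r2'.
rewrite (IH1 _ _ _ _ r1 r1' e1) (IH2 _ _ _ _ r2 r2'); last by lia.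
by rewrite -(rep_start r1) (rep_start r1').
Qed.

Lemma rep_functional s f s' f' o x t : rep s f o x t -> rep s' f' o x t ->
  (forall p, o <= p < o + (tsize t).*2 -> s p = s' p) /\
  (forall p, o <= p <= o + (tsize t).*2 -> f p = f' p).
Proof.
elim: t o x => [|y t1 IH1 t2 IH2] o x /=.
  move=> /eqP fo /eqP fo'; rewrite addn0; split=> p Hp; first lia.
  have -> : p = o by lia.
  by rewrite fo fo'.
move=> /and5P[/eqP fo /eqP so /eqP sp r1 r2] /and5P[/eqP fo' /eqP so' /eqP sp' r1' r2'].
have [s1 f1] := IH1 _ _ r1 r1'; have [s2 f2] := IH2 _ _ r2 r2'.
rewrite doubleS doubleD; split=> p.
  case/positionP => [->|Hp|->|Hp]; rewrite ?so ?so' ?sp ?sp' //.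
    by apply: s1; lia.
  by apply: s2; lia.
move=> Hp; case: (ltngtP p o) => [|lt|->]; [lia| |by rewrite fo fo'].
case: (leqP p (o.+1 + (tsize t1).*2)) => [le|gt]; first by apply: f1; lia.
by apply: f2; lia.
Qed.

Lemma eq_rep s f s' f' o x t :
  (forall p, o <= p < o + (tsize t).*2 -> s p = s' p) ->
  (forall p, o <= p <= o + (tsize t).*2 -> f p = f' p) ->
  rep s f o x t = rep s' f' o x t.
Proof.
elim: t o x => [|y t1 IH1 t2 IH2] o x /=; rewrite ?addn0 => es ef.
  by rewrite ef // leqnn.
rewrite ef ?es; try lia.
by rewrite (IH1 o.+1) 1?(IH2 (o.+1 + (tsize t1).*2).+1) // => p Hp;
  (apply: es || apply: ef); lia.
Qed.

Lemma rep_exists o x t : exists s f, rep s f o x t.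
Proof.
elim: t o x => [|y t1 IH1 t2 IH2] o x; first by exists id, (fun=> x); rewrite /=.
pose c := o.+1 + (tsize t1).*2.
have [s1 [f1 r1]] := IH1 o.+1 y; have [s2 [f2 r2]] := IH2 c.+1 x.
exists (fun p => if p == o then c else if p < c then s1 p else if p == c then o else s2 p).
exists (fun p => if p == o then x else if p <= c then f1 p else f2 p).
rewrite /= -/c !eqxx /=.
have -> : c == o = false by rewrite /c; lia.
have ltoc : o < c by rewrite /c; lia.
rewrite ltnn eqxx /=; apply/andP; split.
  rewrite (@eq_rep _ _ s1 f1) // -/c => p Hp.
    have -> : p == o = false by lia.
    by have -> : p < c by case/andP: Hp.
  have -> : p == o = false by lia.
  by have -> : p <= c by case/andP: Hp.
rewrite (@eq_rep _ _ s2 f2) // => p Hp.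
  have -> : p == o = false by lia.
  have -> : p < c = false by lia.
  by have -> : p == c = false by lia.
have -> : p == o = false by lia.
by have -> : p <= c = false by lia.
Qed.

(** Let [c] be the partner of the first edge. By noncrossing, [s] preserves the positions between
    [o] and [c] and those after [c]; the trees of these two pieces are the two children of
    [Node]. *)
Lemma rep_total L W s f o e : o <= e ->
  (forall p, o <= p < e ->
     [/\ o <= s p < e, s (s p) = p, s p != p, W (s p) = ~~ W p & f (s p).+1 = f p]) ->
  (forall p q, o <= p -> q < e -> p < q -> q < s p -> s q < s p) ->
  (forall p, o <= p < e -> f p < L /\ if W p then f p < f p.+1 else f p.+1 < f p) ->
  f e < L ->
  exists t, [/\ (tsize t).*2 = e - o, rep s f o (f o) t & fits_at L W o (f o) t].
Proof.
move: {2}(e - o) (leqnn (e - o)) => n; elim: n o e => [|n IHn] o e.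
  move=> le leoe; have -> : e = o by lia.
  by move=> *; exists Leaf; rewrite /= subnn eqxx.
move=> leS leoe Hs nc mono fe.
have [->|ltoe] : o = e \/ o < e by lia.
  by exists Leaf; rewrite /= subnn eqxx.
have oo : o <= o < e by rewrite leqnn.
have [Ho sso sno Wo fo] := Hs o oo; set c := s o in Ho sso sno Wo fo.
have ltoc : o < c by lia.
have Hin p : o < p < c -> o < s p < c.
  move=> Hp; have [|Hsp ssp _ _ _] := Hs p; first lia.
  have := nc o p (leqnn o); rewrite -/c => /(_ ltac:(lia) ltac:(lia) ltac:(lia)) ->.
  rewrite andbT ltn_neqAle eq_sym; apply/andP; split; last lia.
  by apply/eqP => e1; move: ssp; rewrite e1 -/c; lia.
(* A partner between [o] and [c] would send [p] back there by [Hin]. *)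
have Hout p : c < p < e -> c < s p < e.
  move=> Hp; have [|Hsp ssp _ _ _] := Hs p; first lia.
  apply/andP; split; last lia.
  case: (ltngtP (s p) c) => // [lt|eq]; last by move: ssp; rewrite eq sso; lia.
  have [eo|gto] : s p = o \/ o < s p by lia.
    by move: ssp; rewrite eo -/c; lia.
  by have := Hin (s p); rewrite ssp; lia.
have [t1 [sz1 r1 f1]] : exists t, [/\ (tsize t).*2 = c - o.+1,
    rep s f o.+1 (f o.+1) t & fits_at L W o.+1 (f o.+1) t].
  apply: IHn; [lia|lia| | | |].
  - by move=> p Hp; have [|_ ? ? ? ?] := Hs p; [lia|]; split=> //; have := Hin p; lia.
  - by move=> p q H1 H2; apply: nc; lia.
  - by move=> p Hp; apply: mono; lia.
  - by case: (mono c) => //; lia.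
have [t2 [sz2 r2 f2]] : exists t, [/\ (tsize t).*2 = e - c.+1,
    rep s f c.+1 (f c.+1) t & fits_at L W c.+1 (f c.+1) t].
  apply: IHn; [lia|lia| | | |] => //.
  - by move=> p Hp; have [|_ ? ? ? ?] := Hs p; [lia|]; split=> //; have := Hout p; lia.
  - by move=> p q H1 H2; apply: nc; lia.
  - by move=> p Hp; apply: mono; lia.
exists (Node (f o.+1) t1 t2); have ec : o.+1 + (tsize t1).*2 = c by lia.
split=> /=; first lia.
  by rewrite ec -/c !eqxx sso eqxx r1 /= -fo.
have [fo1 mo1] : f o.+1 < L /\ side (W o) (f o) (f o.+1).
  have [_ mo] := mono o oo; split.
    by have [lt|eq] : o.+1 < e \/ o.+1 = e by [lia|]; [case: (mono o.+1) => //; lia|rewrite eq].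
  by move: mo; rewrite /side; case: (W o) => //; exact: ltnW.
by rewrite ec Wo eqxx fo1 mo1 f1 -fo f2.
Qed.

End Represent.

(** * Counting walks *)

Section Walks.
Variables (k L : nat) (W : nat -> bool).

(* [q.1] sends an edge of the polygon to the one it is glued to, [q.2] labels the
   vertices of the polygon by the vertices of the tree. *)
Definition is_walk (q : {ffun 'I_k -> 'I_k} * {ffun 'I_k -> 'I_L}) :=
  [&& [forall i, (q.1 (q.1 i) == i) && (q.1 i != i)],
      [forall i : 'I_k, forall j : 'I_k,
         (i < j < q.1 i)%N ==> (q.1 j < q.1 i)%N],
      [forall i : 'I_k, W (q.1 i) == ~~ W i],
      [forall i, q.2 (ordS (q.1 i)) == q.2 i],
      [forall i : 'I_k, if W i then (q.2 i < q.2 (ordS i))%N else (q.2 (ordS i) < q.2 i)%N]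
    & [forall y, exists i, q.2 i == y]].

End Walks.

Section WalkCount.
Local Open Scope nat_scope.
Variables (d : nat) (w : seq bool).
Hypothesis d_gt0 : 0 < d.
Let k := (2 * d)%N.
Let L := d.+1.
Hypothesis size_w : size w = k.
Let W := nth false w.

Let k_gt0 : 0 < k. Proof. by rewrite /k; lia. Qed.
Let i0 : 'I_k := Ordinal k_gt0.

(** Out-of-range positions are sent to 0, which is the right value at [k], where the polygon closes
    up. *)
Definition nat_fun n (g : {ffun 'I_k -> 'I_n}) (p : nat) : nat := g (insubd i0 p).

Lemma nat_fun_ord n (g : {ffun 'I_k -> 'I_n}) (i : 'I_k) : nat_fun g i = g i.
Proof. by rewrite /nat_fun valKd. Qed.

Lemma nat_funS n (g : {ffun 'I_k -> 'I_n}) (i : 'I_k) : nat_fun g i.+1 = g (ordS i).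
Proof.
rewrite /nat_fun; congr (nat_of_ord (g _)); apply: val_inj; rewrite val_insubd /=.
case: ltnP => [lt|ge]; first by rewrite modn_small.
have -> : i.+1 = k by apply/eqP; rewrite eqn_leq ge ltn_ord.
by rewrite modnn.
Qed.

Let repq (xt : nat * ltree) (q : {ffun 'I_k -> 'I_k} * {ffun 'I_k -> 'I_L}) :=
  rep (nat_fun q.1) (nat_fun q.2) 0 xt.1 xt.2.

Let labelled_trees : seq (nat * ltree) :=
  [seq xt <- [seq (x, t) | x <- iota 0 L, t <- trees L k w x]
     | uniq (xt.1 :: labels xt.2)].

Lemma mem_labelled_trees x t : ((x, t) \in labelled_trees) =
  [&& x < L, tsize t == d, fits_at L W 0 x t & uniq (x :: labels t)].
Proof.
have fE : fits L w x t = (tsize t == d) && fits_at L W 0 x t.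
  by rewrite (@fits_atE L W 0) // size_w /k; congr (_ && _); lia.
rewrite mem_filter andbC; rewrite [uniq _]/=.
apply/andP/idP => [[/allpairsPdep[x' [t' [Hx Ht [ex et]]]] u]|].
  rewrite -ex in Hx Ht; move: Ht; rewrite -et; rewrite mem_trees ?size_w // fE => /andP[-> ->].
  by rewrite mem_iota in Hx; apply/and4P; split=> //; lia.
move=> /and4P[ltx st ft u]; split=> //; apply/allpairsPdep; exists x, t.
by rewrite mem_iota mem_trees ?size_w // fE st ft; split=> //; lia.
Qed.

Lemma labelled_trees_uniq : uniq labelled_trees.
Proof.
apply: filter_uniq; apply: allpairs_uniq_dep => [|x _|].
- exact: iota_uniq.
- by apply: trees_uniq; rewrite size_w.
by move=> [x t] [x' t'] _ _ [-> ->].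
Qed.

Lemma fits_labels W' o x t : x < L -> fits_at L W' o x t -> all (fun y => y < L) (x :: labels t).
Proof.
elim: t o x => [|y t1 IH1 t2 IH2] o x ltx /=; first by rewrite ltx.
move=> /and5P[_ lty _ /(IH1 _ _ lty) /= H1 /(IH2 _ _ ltx) /= H2].
by rewrite ltx all_cat; move: H1 H2 => /andP[-> ->] /andP[_ ->].
Qed.

Lemma tree_walk xt : xt \in labelled_trees -> exists2 q, is_walk W q & repq xt q.
Proof.
case: xt => x t; rewrite mem_labelled_trees => /and4P[ltx /eqP st ft u].
have [s [f r]] := rep_exists 0 x t.
have tk : 0 + (tsize t).*2 = k by rewrite st -mul2n.
have labL z : z \in x :: labels t -> z < L.
  by have /allP := fits_labels ltx ft; apply.
have fL p : p <= k -> f p < L.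
  by move=> le; apply: labL; apply: (rep_image r); rewrite tk.
have part p : p < k -> [/\ 0 <= s p < 0 + (tsize t).*2, s (s p) = p & s p != p].
  by move=> lt; apply: (rep_partner r); rewrite tk.
pose q := ([ffun i : 'I_k => insubd i0 (s i)], [ffun i : 'I_k => insubd (ord0 : 'I_L) (f i)]).
have q1E p : p < k -> nat_fun q.1 p = s p.
  move=> lt; rewrite /nat_fun ffunE !val_insubd lt.
  by have [] := part p lt; rewrite tk => /andP[_ ->].
have q2E p : p <= k -> nat_fun q.2 p = f p.
  move=> le; have fi : f (insubd i0 p) = f p.
    rewrite val_insubd; case: (ltnP p k) => // ge.
    have -> : p = k by apply/eqP; rewrite eqn_leq le.
    by rewrite (rep_start r) -tk (rep_end r).
  by rewrite /nat_fun ffunE val_insubd fi fL.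
have rq : repq (x, t) q.
  by rewrite /repq (@eq_rep _ _ s f) // tk => p Hp; [exact: q1E | exact: q2E].
exists q => //.
have e1 (i : 'I_k) : q.1 i = s i :> nat by rewrite -nat_fun_ord q1E.
have e2 (i : 'I_k) : q.2 i = f i :> nat by rewrite -nat_fun_ord q2E // ltnW.
have e2S (i : 'I_k) : q.2 (ordS i) = f i.+1 :> nat by rewrite -nat_funS q2E.
have rng (i : 'I_k) : 0 <= i < 0 + (tsize t).*2 by rewrite tk ltn_ord.
apply/and5P; split; last apply/andP; [| | | |split].
- apply/forallP => i; have [_ ss sn] := part i (ltn_ord i).
  by rewrite -!val_eqE /= !e1 ss sn eqxx.
- apply/forallP => i; apply/forallP => j; apply/implyP; rewrite !e1 => /andP[lt1 lt2].
  by apply: (rep_noncrossing r) => //; rewrite tk.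
- by apply/forallP => i; rewrite e1 (rep_letter r ft).
- by apply/forallP => i; rewrite -val_eqE /= e2S e1 e2 (rep_glue r).
- apply/forallP => i; rewrite e2 e2S; exact: (rep_monotone r ft u (rng i)).
apply/forallP => y.
(* The [d.+1] distinct labels below [L = d.+1] are all the labels. *)
have ylab : (y : nat) \in x :: labels t.
  have sub : {subset x :: labels t <= iota 0 L} by move=> z /labL; rewrite mem_iota.
  have [|_ ->] := uniq_min_size u sub; last by rewrite mem_iota /=.
  by rewrite size_iota /= size_labels st.
have [p Hp fp] := rep_label r ylab.
apply/existsP; exists (insubd i0 p); rewrite -val_eqE /= -fp -q2E //.
by rewrite -tk; case/andP: Hp.
Qed.

Lemma walk_tree q : is_walk W q -> exists2 xt, xt \in labelled_trees & repq xt q.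
Proof.
move=> /and5P[/forallP inv /forallP nc /forallP let_ /forallP glue /andP[/forallP mono /forallP sur]].
have e1 (i : 'I_k) := nat_fun_ord q.1 i.
have e2 (i : 'I_k) := nat_fun_ord q.2 i.
have e2S (i : 'I_k) := nat_funS q.2 i.
have [||||t] := @rep_total L W (nat_fun q.1) (nat_fun q.2) 0 k (leq0n k).
- move=> p /= lt; rewrite -[p]/(nat_of_ord (Ordinal lt)); set i := Ordinal lt.
  have /andP[/eqP ss sn] := inv i.
  rewrite e1 e1 e2S e2 ss sn; split=> //; first exact/eqP/let_.
  by have /eqP -> := glue i.
- move=> p p' _ lt' ltp; have lt := ltn_trans ltp lt'.
  rewrite -[p]/(nat_of_ord (Ordinal lt)) -[p']/(nat_of_ord (Ordinal lt')) !e1 => H.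
  by have /forallP/(_ (Ordinal lt'))/implyP := nc (Ordinal lt); apply; rewrite /= ltp.
- move=> p /= lt; rewrite -[p]/(nat_of_ord (Ordinal lt)) e2 e2S ltn_ord; split=> //.
- by rewrite /nat_fun ltn_ord.
move=> [szt r f]; set x := nat_fun q.2 0 in r f.
have st : tsize t = d by move: szt; rewrite /k; lia.
(* Conversely, [L] values taken on a list of [d.+1] labels leave no room for a repetition. *)
have u : uniq (x :: labels t).
  apply: (leq_size_uniq (iota_uniq 0 L)); last by rewrite size_iota /= size_labels st.
  move=> y; rewrite mem_iota => /andP[_ lty].
  have /existsP[i /eqP ei] := sur (Ordinal lty).
  have -> : y = nat_fun q.2 i by rewrite e2 ei.
  by apply: (rep_image r); rewrite szt subn0 add0n /= ltnW.
exists (x, t) => //; rewrite mem_labelled_trees st eqxx f u.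
by rewrite /x /nat_fun ltn_ord.
Qed.

(** [repq] is the graph of a bijection: injectivity is [rep_inj], surjectivity is [walk_tree]
    together with [rep_functional]. *)
Lemma size_labelled_trees :
  size labelled_trees = #|[set q : {ffun 'I_k -> 'I_k} * {ffun 'I_k -> 'I_L} | is_walk W q]|.
Proof.
pose q0 : {ffun 'I_k -> 'I_k} * {ffun 'I_k -> 'I_L} := ([ffun=> i0], [ffun=> ord0]).
pose g xt := odflt q0 [pick q | is_walk W q && repq xt q].
have gP xt : xt \in labelled_trees -> is_walk W (g xt) /\ repq xt (g xt).
  move=> /tree_walk[q Hq rq]; rewrite /g; case: pickP => [q' /andP[] //|/(_ q)].
  by rewrite Hq rq.
have szE xt : xt \in labelled_trees -> tsize xt.2 = d.
  by case: xt => x t; rewrite mem_labelled_trees => /and4P[_ /eqP].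
have gi : {in labelled_trees &, injective g}.
  move=> xt xt' H H' eg; have [_ r] := gP _ H; have [_ r'] := gP _ H'.
  rewrite -eg in r'; have [e1 e2] := rep_inj r r' (etrans (szE _ H) (esym (szE _ H'))).
  by case: xt xt' e1 e2 {H H' eg r r'} => ? ? [? ?] /= -> ->.
rewrite -(size_map g) -(card_uniqP _); last by rewrite map_inj_in_uniq ?labelled_trees_uniq.
apply: eq_card => q; rewrite inE; apply/mapP/idP => [[xt /gP[Hq _] -> //]|Hq].
have [xt Hxt r] := walk_tree Hq; exists xt => //.
have [_ r'] := gP _ Hxt; have [es ef] := rep_functional r r'.
rewrite (szE _ Hxt) add0n -mul2n in es ef.
case: q (g xt) es ef {Hq r r'} => [q1 q2] [q1' q2'] /= es ef.
congr (_, _); apply/ffunP => i; apply: val_inj => /=; rewrite -!nat_fun_ord.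
  by apply: es; rewrite ltn_ord.
by apply: ef; rewrite ltnW ?ltn_ord.
Qed.

(** A repeated label gives weight zero; otherwise each of the [L] labels occurs exactly once and the
    weight is the full product. *)
Lemma sum_tree_sum (R : comNzRingType) (theta : nat -> R) :
  (forall x, theta x * theta x = 0)%R ->
  (\sum_(0 <= x < L) theta x * tree_sum L theta k w x =
   (\prod_(x < L) theta x) *+
     #|[set q : {ffun 'I_k -> 'I_k} * {ffun 'I_k -> 'I_L} | is_walk W q]|)%R.
Proof.
move=> theta2; rewrite -size_labelled_trees.
transitivity (\sum_(xt <- [seq (x, t) | x <- iota 0 L, t <- trees L k w x])
   \prod_(y <- xt.1 :: labels xt.2) theta y)%R.
  rewrite big_allpairs_dep /index_iota subn0; apply: eq_bigr => x _.
  rewrite /tree_sum mulr_sumr; apply: eq_bigr => t _.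
  by rewrite big_cons.
rewrite (bigID (fun xt => uniq (xt.1 :: labels xt.2))) /= [X in (_ + X)%R]big1 ?addr0; last first.
  by move=> xt nu; rewrite (prod_nonuniq theta2).
rewrite -big_filter -/labelled_trees big_seq.
rewrite (eq_bigr (fun=> \prod_(x < L) theta x)%R) => [|[x t]].
  by rewrite -big_seq big_const_seq count_predT iter_addr_0.
rewrite mem_labelled_trees => /and4P[ltx /eqP st ft u] /=.
have sub : {subset x :: labels t <= iota 0 L}.
  by move=> z /(allP (fits_labels ltx ft)); rewrite mem_iota.
have [|_ eqi] := uniq_min_size u sub; first by rewrite size_iota /= size_labels st.
rewrite (perm_big (iota 0 L)); last by apply: uniq_perm => //; exact: iota_uniq.
by rewrite -(big_mkord xpredT theta) /index_iota subn0.
Qed.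

End WalkCount.

(** * Vertices of the quotient tree *)

Section PairingPartner.
Variable k : nat.
Implicit Types (sigma : {set {set 'I_k}}) (s : {ffun 'I_k -> 'I_k}).

Definition pairs s : {set {set 'I_k}} := [set [set i; s i] | i : 'I_k].

Definition partner sigma : {ffun 'I_k -> 'I_k} :=
  [ffun i => odflt i [pick j | (j != i) && ([set i; j] \in sigma)]].

Definition fixfree_involution s := forall i, s (s i) = i /\ s i != i.

Lemma mem_pairs s i j : fixfree_involution s ->
  ([set i; j] \in pairs s) = (j == s i).
Proof.
move=> inv; apply/imsetP/eqP => [[a _ /setP e]|->]; last by exists i.
have [ssa sna] := inv a.
have := e i; rewrite !inE eqxx => /esym/orP[]/eqP ei; subst i.
  by have := e (s a); rewrite !inE eqxx orbT (negPf sna) => /eqP.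
by have := e a; rewrite !inE eqxx [a == s a]eq_sym (negPf sna) ssa => /eqP.
Qed.

Lemma pairs_pairing s : fixfree_involution s -> pairing (pairs s).
Proof.
move=> inv; apply/andP; split; last first.
  apply/forall_inP => B /imsetP[a _ ->]; have [_ sna] := inv a.
  by rewrite cards2 [a == _]eq_sym sna.
apply/and3P; split.
- apply/eqP/setP => i; rewrite inE; apply/bigcupP; exists [set i; s i].
    by apply/imsetP; exists i.
  by rewrite !inE eqxx.
- apply/trivIsetP => A B /imsetP[a _ ->] /imsetP[b _ ->] ne.
  apply/pred0P => i; apply/negbTE; apply: contra ne => /andP[].
  have E c : i \in [set c; s c] -> [set c; s c] = [set i; s i].
    by rewrite !inE => /orP[]/eqP ->; rewrite ?(proj1 (inv c)) // setUC.
  by move=> /E -> /E ->.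
- apply/imsetP => -[a _ /setP/(_ a)]; by rewrite !inE eqxx.
Qed.

Section Pairing.
Variable sigma : {set {set 'I_k}}.
Hypothesis sigmaP : pairing sigma.

Lemma pairing_block i : exists2 j, j != i & [set i; j] \in sigma.
Proof.
have [/andP[/eqP cov _] /forall_inP c2] := andP sigmaP.
have : i \in cover sigma by rewrite cov inE.
case/bigcupP => B BS iB; have /cards2P[a [b [nab eB]]] := c2 B BS.
move: iB; rewrite eB !inE => /orP[]/eqP ei; subst i.
  by exists b; rewrite 1?eq_sym // -eB.
by exists a => //; rewrite setUC -eB.
Qed.

Lemma partnerP i : partner sigma i != i /\ [set i; partner sigma i] \in sigma.
Proof.
rewrite ffunE; case: pickP => [j /andP[] //|none].
by have [j ne jS] := pairing_block i; have := none j; rewrite ne jS.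
Qed.

Lemma partner_unique i j : [set i; j] \in sigma -> j = partner sigma i.
Proof.
move=> ijS; have [ne pS] := partnerP i.
have [/and3P[_ tI _] /forall_inP c2] := andP sigmaP.
have nij : j != i.
  by apply: contraTneq (c2 _ ijS) => ->; rewrite setUid cards1.
have /setP/(_ j) : [set i; j] = [set i; partner sigma i].
  apply/eqP; apply: contraT => neq; have /trivIsetP/(_ _ _ ijS pS neq) := tI.
  by move/pred0P/(_ i); rewrite /= !inE eqxx.
by rewrite !inE eqxx orbT (negPf nij) => /esym/eqP.
Qed.

Lemma partner_involution : fixfree_involution (partner sigma).
Proof.
move=> i; have [ne pS] := partnerP i; split=> //.
by apply/esym/partner_unique; rewrite setUC.
Qed.

Lemma pairs_partner : pairs (partner sigma) = sigma.
Proof.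
have [/and3P[_ _ n0] /forall_inP c2] := andP sigmaP.
apply/setP => B; apply/imsetP/idP => [[i _ ->]|BS]; first by case: (partnerP i).
have /cards2P[a [b [nab eB]]] := c2 B BS; exists a => //.
by rewrite -(@partner_unique a b) // -eB.
Qed.

End Pairing.

Lemma partner_pairs s : fixfree_involution s -> partner (pairs s) = s.
Proof.
move=> inv; apply/ffunP => i; apply/esym/partner_unique; first exact: pairs_pairing.
by rewrite mem_pairs.
Qed.

(** The only configuration to exclude is [i < j < s i < s j]; equal far ends would force [i = j]. *)
Lemma noncrossing_pairs s : fixfree_involution s ->
  noncrossing (pairs s) <->
  forall i j : 'I_k, (i < j < s i)%N -> (s j < s i)%N.
Proof.
move=> inv; split=> [nc i j /andP[ltij ltjs]|nc].
  rewrite ltnNge; apply: contra nc; rewrite leq_eqVlt => /orP[/eqP e|lt].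
    have e' : s i = s j by apply: val_inj.
    by move: ltij; rewrite -(proj1 (inv i)) e' (proj1 (inv j)) ltnn.
  apply/existsP; exists i; apply/existsP; exists j; apply/existsP; exists (s i).
  by apply/existsP; exists (s j); rewrite ltij ltjs lt !mem_pairs // !eqxx.
apply/negP => /existsP[p /existsP[q /existsP[r /existsP[t]]]].
rewrite !mem_pairs // => /and5P[lpq lqr lrt /eqP er /eqP et].
by have := nc p q; rewrite lpq -er lqr -et => /(_ isT); lia.
Qed.

End PairingPartner.

Section Classes.
Variables (d : nat) (s : {ffun 'I_(2 * d) -> 'I_(2 * d)}).
Local Notation k := (2 * d)%N.
Hypothesis k_gt0 : (0 < k)%N.
Hypothesis inv : fixfree_involution s.
Hypothesis nc : forall i j : 'I_k, (i < j < s i)%N -> (s j < s i)%N.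
Let i0 : 'I_k := Ordinal k_gt0.
Let V := quotient_vertices (pairs s).
Let cl (i : 'I_k) := pblock V i.

Let R := [rel x y | glued (pairs s) x y || glued (pairs s) y x].

Lemma gluedE x y : glued (pairs s) x y = (y == ordS (s x)) || (x == ordS (s y)).
Proof.
apply/existsP/orP => [[i /existsP[j /andP[]]]|].
  rewrite mem_pairs // => /eqP-> /orP[]/andP[/eqP-> /eqP->]; first by left.
  by right; rewrite (proj1 (inv i)).
case=> /eqP->.
  by exists x; apply/existsP; exists (s x); rewrite mem_pairs // !eqxx.
exists (s y); apply/existsP; exists y.
by rewrite mem_pairs // (proj1 (inv y)) !eqxx orbT.
Qed.

Let conn_equiv : {in [set: 'I_k] & &, equivalence_rel (connect R)}.
Proof.
move=> x y z _ _ _; split=> [|xy]; first exact: connect0.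
have sym : connect_sym R by apply: sym_connect_sym => a b; rewrite /R /= orbC.
by apply/idP/idP; apply: connect_trans => //; rewrite sym.
Qed.

Lemma class_eq x y : (cl x == cl y) = connect R x y.
Proof.
have /and3P[/eqP cov tI _] := equivalence_partitionP conn_equiv.
rewrite /cl /V eq_pblock ?cov ?inE //.
by rewrite (pblock_equivalence_partition conn_equiv) ?inE.
Qed.

Lemma class_glue i : cl (ordS (s i)) = cl i.
Proof.
apply/eqP; rewrite class_eq; apply: connect1.
by rewrite /R /= !gluedE eqxx !orbT.
Qed.

(** Universal property of the quotient: a function respecting the generating identifications
    descends to the classes. *)
Lemma class_constant (T : eqType) (g : 'I_k -> T) :
  (forall i, g (ordS (s i)) = g i) -> forall x y, cl x = cl y -> g x = g y.
Proof.
move=> gS x y /eqP; rewrite class_eq => /connectP[p].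
elim: p x => [|z p IHp] x /=; first by move=> _ ->.
case/andP=> Rxz pp ey; rewrite -(IHp z pp ey).
by move: Rxz; rewrite !gluedE => /orP[]/orP[]/eqP->; rewrite gS.
Qed.

Lemma vertices_image : V = [set cl i | i : 'I_k].
Proof.
have VP := equivalence_partitionP conn_equiv; have /and3P[/eqP cov tI n0] := VP.
apply/setP => c; apply/idP/imsetP => [cV|[i _ ->]].
  have /set0Pn[i ic] : c != set0 by apply: contraNneq n0 => <-.
  by exists i => //; apply/esym/def_pblock.
by apply: pblock_mem; rewrite cov inE.
Qed.

Lemma mem_vertices i : cl i \in V.
Proof. by rewrite vertices_image; apply/imsetP; exists i. Qed.

Let openers := [set i : 'I_k | (i < s i)%N].

Lemma card_openers : #|openers| = d.
Proof.
have s_inj : injective s by apply: (can_inj (g := s)) => i; case: (inv i).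
have closers : ~: openers = s @: openers.
  apply/setP => i; rewrite !inE -leqNgt; apply/idP/imsetP => [le|[j]].
    exists (s i); last by case: (inv i).
    by rewrite inE (proj1 (inv i)) ltn_neqAle le andbT; case: (inv i).
  by rewrite inE => lt ->; rewrite (proj1 (inv j)) ltnW.
have := cardsC openers; rewrite closers (card_imset _ s_inj) card_ord addnn -mul2n.
by move=> /eqP; rewrite eqn_pmul2l // => /eqP.
Qed.

(* [enclosing p] is the right end of the innermost edge pair straddling position
   [p]: a name for the vertex of the tree at [p]. *)
Let enclosing (p : nat) : nat := \max_(i : 'I_k | (i < p <= s i)%N) i.+1.

Let enclosing_glue i : enclosing (ordS (s i)) = enclosing i.
Proof.
(* The index wraps around at the last edge, but neither position 0 nor position [k] is straddled by
   a pair. *)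
have eS (j : 'I_k) : enclosing (ordS j) = enclosing j.+1.
  rewrite /enclosing /=; case: (ltnP j.+1 k) => [lt|ge]; first by rewrite modn_small.
  have e : j.+1 = k by apply/eqP; rewrite eqn_leq ge ltn_ord.
  rewrite e modnn !big_pred0 // => j'.
  by rewrite [(k <= _)%N]leqNgt !ltn_ord.
rewrite eS; apply: eq_bigl => j.
have [ssi sni] := inv i; have [ssj snj] := inv j.
have vne : (s i != i :> nat) && (s j != j :> nat) by apply/andP.
have n1 := nc (i := i) (j := j); have n2 := nc (i := j) (j := i).
have n3 := nc (i := s i) (j := j); have n4 := nc (i := j) (j := s i).
have n5 := nc (i := i) (j := s j).
rewrite ssi in n3 n4.
have [e1|ne1] := eqVneq (s j : nat) i.
  have e : s j = i by apply: val_inj.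
  have e2 : s i = j by rewrite -e.
  rewrite e2 e in n1 n2 n3 n4 vne *; lia.
have [e1'|ne1'] := eqVneq (j : nat) i.
  have e : j = i by apply: val_inj.
  by rewrite e !ltnn andbF.
have ne2 : (s i : nat) != j by apply: contra ne1 => /eqP/val_inj <-; rewrite ssi.
have ne3 : (s i : nat) != s j.
  by apply: contra ne1' => /eqP/val_inj e; rewrite -ssi e ssj.
clear -vne n1 n2 n3 n4 ne1 ne1' ne2 ne3; lia.
Qed.

(** Every vertex of the tree is first reached at position 0 or at the end of an opening edge, and
    [d] of the edges are openers. The positions in [D] meet all classes and are separated by
    [enclosing]. *)
Lemma card_vertices : #|V| = d.+1.
Proof.
pose D := i0 |: [set ordS i | i in openers].
have DS i : i \in openers -> ordS i = i.+1 :> nat.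
  rewrite inE => lt; rewrite /= modn_small //.
  by apply: leq_ltn_trans lt _; rewrite ltn_ord.
have encD p : p \in D -> enclosing p = p.
  rewrite !inE => /orP[/eqP->|/imsetP[i iO ->]].
    by rewrite /enclosing big_pred0.
  rewrite (DS _ iO) /enclosing; apply/eqP; rewrite eqn_leq; apply/andP; split.
    by apply/bigmax_leqP => j /andP[].
  rewrite inE in iO; apply: (@leq_bigmax_cond _ _ (fun i : 'I_k => i.+1)).
  by rewrite ltnSn.
have VD : V = cl @: D.
  rewrite vertices_image; apply/setP => c; apply/imsetP/imsetP => [[p _ ->]|[p _ ->]]; last by exists p.
  (* Descent on the position: if the edge before [p] closes a pair, [p] is glued to the start of its
     partner, which comes earlier. *)
  move: {2}(p : nat) (leqnn p) => n; elim: n p => [|n IHn] p lepn.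
    by exists p => //; rewrite !inE -val_eqE /= -leqn0 lepn.
  case: (posnP p) => [p0|p_gt0]; first by exists p => //; rewrite !inE -val_eqE /= p0.
  have ltq : (p.-1 < k)%N by apply: leq_ltn_trans (leq_pred p) (ltn_ord p).
  pose q : 'I_k := Ordinal ltq.
  have eq : p = ordS q by apply: val_inj; rewrite /= prednK // modn_small.
  case: (ltnP q (s q)) => [lt|ge].
    by exists p => //; rewrite !inE eq imset_f ?orbT // inE.
  have -> : cl p = cl (s q) by rewrite eq -[in LHS](proj1 (inv q)) class_glue.
  by apply: IHn; have := lepn; move: ge p_gt0; rewrite /q /=; lia.
rewrite VD card_in_imset => [|x y xD yD e]; last first.
  by apply: val_inj; rewrite /= -(encD x) // -(encD y) //;
  exact: (class_constant (g := fun p : 'I_k => enclosing p) enclosing_glue e).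
rewrite cardsU1 card_imset; last exact: ordS_inj.
rewrite card_openers; case: imsetP => // -[i iO e].
by have := DS i iO; rewrite -e.
Qed.

End Classes.

(** * Ordered trees and walks *)

Section OrderedTrees.
Variable d : nat.
Local Notation k := (2 * d)%N.
Local Notation L := d.+1.
Hypothesis k_gt0 : (0 < k)%N.
Implicit Types (s : {ffun 'I_k -> 'I_k}) (f : {ffun 'I_k -> 'I_L}).

Let cl s (i : 'I_k) := pblock (quotient_vertices (pairs s)) i.

Definition label_order s f : {set {set 'I_k} * {set 'I_k}} :=
  [set (cl s p.1, cl s p.2) | p : 'I_k * 'I_k & (f p.1 < f p.2)%N].

Section FromWalk.
Variables (s : {ffun 'I_k -> 'I_k}) (f : {ffun 'I_k -> 'I_L}).
Hypothesis inv : fixfree_involution s.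
Hypothesis nc : forall i j : 'I_k, (i < j < s i)%N -> (s j < s i)%N.
Hypothesis f_glue : forall i, f (ordS (s i)) = f i.
Hypothesis f_onto : forall y, exists i, f i == y.
Let V := quotient_vertices (pairs s).

Let vertex y := cl s (xchoose (f_onto y)).

Let f_class x y : cl s x = cl s y -> f x = f y.
Proof. exact: class_constant. Qed.

Let vertex_label y i : vertex y = cl s i -> f i = y.
Proof. by move=> e; rewrite -(f_class e); apply/eqP/(xchooseP (f_onto y)). Qed.

Let vertex_inj : injective vertex.
Proof. by move=> y z /vertex_label <-; apply/eqP/(xchooseP (f_onto z)). Qed.

(** There are as many classes as labels, so the injection from labels to classes is onto and each
    class is determined by its label. *)
Let vertex_onto : vertex @: setT = V.
Proof.
apply/eqP; rewrite eqEcard card_imset // cardsT card_ord (card_vertices k_gt0 inv nc) leqnn andbT.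
by apply/subsetP => c /imsetP[y _ ->]; exact: mem_vertices.
Qed.

Lemma vertex_of i : vertex (f i) = cl s i.
Proof.
have /imsetP[y _ e] : cl s i \in vertex @: setT by rewrite vertex_onto; exact: mem_vertices.
by rewrite e (vertex_label (esym e)).
Qed.

Lemma mem_label_order i j : ((cl s i, cl s j) \in label_order s f) = (f i < f j)%N.
Proof.
apply/imsetP/idP => [[[a b] /=]|lt]; last by exists (i, j); rewrite ?inE.
by rewrite inE /= => lt [/f_class-> /f_class->].
Qed.

Lemma vertexP c : c \in V -> exists i, c = cl s i.
Proof. by rewrite -vertex_onto => /imsetP[y _ ->]; eexists. Qed.

Lemma label_order_total : strict_total_order V (label_order s f).
Proof.
apply/and4P; split.
- apply/subsetP => p /imsetP[[i j] _ ->] /=.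
  by rewrite in_setX !mem_vertices.
- by apply/forall_inP => c /vertexP[i ->]; rewrite mem_label_order ltnn.
- apply/forall_inP => c /vertexP[i ->]; apply/forall_inP => c' /vertexP[j ->].
  apply/forall_inP => c'' /vertexP[l ->]; rewrite !mem_label_order; apply/implyP => /andP[].
  exact: ltn_trans.
apply/forall_inP => c /vertexP[i ->]; apply/forall_inP => c' /vertexP[j ->].
rewrite !mem_label_order -neq_ltn; apply/implyP; apply: contra => /eqP/val_inj e.
by rewrite -!vertex_of e.
Qed.

Lemma label_order_compatible (eps : k.-tuple int) :
  (forall i, f (target eps i) < f (source eps i))%N ->
  order_compatible eps (pairs s) (label_order s f).
Proof.
move=> mono.
have arrowP y z : arrow eps (pairs s) y z ->
    exists i, y = cl s (source eps i) /\ z = cl s (target eps i).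
  by move=> /existsP[i /andP[/eqP-> /eqP->]]; exists i.
have down a z : connect (arrow eps (pairs s)) (cl s a) z ->
    exists2 b, z = cl s b & (f b <= f a)%N.
  move=> /connectP[p]; elim: p a => [|c p IHp] a /=; first by move=> _ ->; exists a.
  move=> /andP[/arrowP[i [ea ec]] pp ez]; rewrite ec in pp ez.
  have [b zb leb] := IHp _ pp ez; exists b => //.
  by rewrite (f_class ea); apply: leq_trans leb (ltnW (mono i)).
apply/forall_inP => x /vertexP[i ex]; apply/forall_inP => y /vertexP[j ey].
apply/implyP => /existsP[z /andP[/arrowP[a [ya za]]]]; rewrite za => /down[b xb leb].
by rewrite ya xb mem_label_order; apply: leq_ltn_trans leb (mono a).
Qed.

(** This recovers the labelling from the order alone, which makes the passage from walks to ordered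
    trees injective. *)
Lemma label_rank i : (f i : nat) = #|[set c in V | (c, cl s i) \in label_order s f]|.
Proof.
have -> : [set c in V | (c, cl s i) \in label_order s f] =
    vertex @: [set y : 'I_L | (y < f i)%N].
  apply/setP => c; rewrite inE; apply/andP/imsetP => [[/vertexP[j ->]]|[y]].
    by rewrite mem_label_order => lt; exists (f j); rewrite ?inE // vertex_of.
  rewrite inE => lt ->; split; first exact: mem_vertices.
  by rewrite mem_label_order (eqP (xchooseP (f_onto y))).
rewrite card_imset // -sum1_card.
rewrite (eq_bigl (fun y : 'I_L => (y < f i)%N)) => [|y]; last by rewrite inE.
rewrite -(big_ord_widen L (fun=> 1%N)) ?sum1_card ?card_ord // ltnW //.
Qed.

End FromWalk.

Section FromTree.
Variables (eps : k.-tuple int) (sigma : {set {set 'I_k}}).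
Variable lt : {set {set 'I_k} * {set 'I_k}}.
Hypothesis sigmaP : pairing sigma.
Hypothesis sigma_nc : noncrossing sigma.
Hypothesis ltP : strict_total_order (quotient_vertices sigma) lt.
Hypothesis lt_compat : order_compatible eps sigma lt.
Let V := quotient_vertices sigma.
Let s := partner sigma.
Let inv : fixfree_involution s := partner_involution sigmaP.
Let es : pairs s = sigma := pairs_partner sigmaP.

Lemma partner_nc : forall i j : 'I_k, (i < j < s i)%N -> (s j < s i)%N.
Proof. by apply/(noncrossing_pairs inv); rewrite es. Qed.

(** Labelling each vertex by the number of smaller ones inverts [label_order]. *)
Let rank (c : {set 'I_k}) := #|[set c' in V | (c', c) \in lt]|.

Let mem_cl i : cl s i \in V.
Proof. by rewrite /V -es; exact: mem_vertices. Qed.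

Let lt_irr c : c \in V -> (c, c) \notin lt.
Proof. by case/and4P: ltP => _ /forall_inP + _ _; apply. Qed.

Let lt_trans a b c : a \in V -> b \in V -> c \in V ->
  (a, b) \in lt -> (b, c) \in lt -> (a, c) \in lt.
Proof.
case/and4P: ltP => _ _ /forall_inP tr _ aV bV cV ab bc.
have /forall_inP/(_ b bV)/forall_inP/(_ c cV)/implyP := tr a aV.
by apply; rewrite ab.
Qed.

Let lt_total a b : a \in V -> b \in V -> a != b -> (a, b) \in lt \/ (b, a) \in lt.
Proof.
case/and4P: ltP => _ _ _ /forall_inP tot aV bV ne.
by have /forall_inP/(_ b bV)/implyP/(_ ne)/orP := tot a aV.
Qed.

Let rank_lt a b : a \in V -> b \in V -> (a, b) \in lt -> (rank a < rank b)%N.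
Proof.
move=> aV bV ab; apply/proper_card/properP; split.
  apply/subsetP => c; rewrite !inE => /andP[cV ca].
  by rewrite cV (lt_trans cV aV bV).
by exists a; rewrite !inE aV ?ab //= (negPf (lt_irr aV)).
Qed.

Let rankE a b : a \in V -> b \in V -> (rank a < rank b)%N = ((a, b) \in lt).
Proof.
move=> aV bV; apply/idP/idP => [|/rank_lt->] // ltr.
have [e|ne] := eqVneq a b; first by rewrite e ltnn in ltr.
have [//|/rank_lt ltr'] := lt_total aV bV ne.
by have := ltn_trans ltr (ltr' bV aV); rewrite ltnn.
Qed.

Let rank_inj : {in V &, injective rank}.
Proof.
move=> a b aV bV e; apply/eqP; apply: contraT => /(lt_total aV bV).
by case=> /rank_lt; rewrite e ltnn => /(_ ltac:(done) ltac:(done)).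
Qed.

Let rank_bound c : c \in V -> (rank c < L)%N.
Proof.
move=> cV; have <- : #|V| = L by rewrite /V -es (card_vertices k_gt0 inv partner_nc).
apply/proper_card/properP; split; first by apply/subsetP => c'; rewrite inE => /andP[].
by exists c => //; rewrite inE (negPf (lt_irr cV)) andbF.
Qed.

Definition rank_label : {ffun 'I_k -> 'I_L} := [ffun i => inord (rank (cl s i))].

Lemma rank_labelE i : (rank_label i : nat) = rank (cl s i).
Proof. by rewrite ffunE inordK // rank_bound. Qed.

Lemma rank_label_glue i : rank_label (ordS (s i)) = rank_label i.
Proof. by apply: val_inj; rewrite /= !rank_labelE /cl class_glue. Qed.

Lemma rank_label_onto y : exists i, rank_label i == y.
Proof.
have onto : (fun c => inord (rank c) : 'I_L) @: V = setT.
  apply/eqP; rewrite eqEcard subsetT cardsT card_ord card_in_imset.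
    by rewrite /V -es (card_vertices k_gt0 inv partner_nc) leqnn.
  move=> a b aV bV /(congr1 val); rewrite /= !inordK ?rank_bound //.
  exact: rank_inj.
have /imsetP[c cV ->] : y \in (fun c => inord (rank c) : 'I_L) @: V by rewrite onto inE.
have : c \in [set cl s i | i : 'I_k].
  by rewrite -(vertices_image s) es.
by case/imsetP => i _ ->; exists i; rewrite ffunE.
Qed.

Lemma rank_label_mono i : (rank_label (target eps i) < rank_label (source eps i))%N.
Proof.
rewrite !rank_labelE rankE //.
have /forall_inP/(_ _ (mem_cl (target eps i)))/forall_inP := lt_compat.
move=> /(_ _ (mem_cl (source eps i)))/implyP; apply.
apply/existsP; exists (cl s (target eps i)); rewrite connect0 andbT.
by apply/existsP; exists i; rewrite /cl es !eqxx.
Qed.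

Lemma rank_label_order : label_order s rank_label = lt.
Proof.
have sub : lt \subset setX V V by case/and4P: ltP.
have VE : V = [set cl s i | i : 'I_k] by rewrite -(vertices_image s) es.
apply/setP => -[a b]; apply/imsetP/idP => [[[i j] /= + [-> ->]]|ab].
  by rewrite inE /= !rank_labelE rankE.
have := subsetP sub _ ab; rewrite in_setX {1 2}VE => /andP[/imsetP[i _ ea] /imsetP[j _ eb]].
by exists (i, j); rewrite /= -?ea -?eb // inE /= !rank_labelE -ea -eb rankE // ?ea ?eb.
Qed.

End FromTree.

(** The bijection [psi] turns the partner map into a pairing and the labels into an order; its
    inverse is given by [partner] and [rank_label]. *)
Lemma card_ordered_trees (eps : k.-tuple int) :
  (forall i, tnth eps i = 1 \/ tnth eps i = -1) ->
  let W := nth false [seq e == 1 | e <- eps] in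
  #|ordered_trees eps| =
  #|[set q : {ffun 'I_k -> 'I_k} * {ffun 'I_k -> 'I_L} | is_walk W q]|.
Proof.
move=> sgn W.
have WE (i : 'I_k) : W i = (tnth eps i == 1).
  by rewrite /W (nth_map 0) ?size_tuple // -tnth_nth.
have oppE (i j : 'I_k) : (tnth eps i + tnth eps j == 0) = (W j == ~~ W i).
  by rewrite !WE; case: (sgn i) => ->; case: (sgn j) => ->.
have monoE (f : {ffun 'I_k -> 'I_L}) (i : 'I_k) :
    (if W i then (f i < f (ordS i))%N else (f (ordS i) < f i)%N) =
    (f (target eps i) < f (source eps i))%N.
  by rewrite WE /target /source; case: ifP.
pose psi (q : {ffun 'I_k -> 'I_k} * {ffun 'I_k -> 'I_L}) := (pairs q.1, label_order q.1 q.2).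
have walkP (q : {ffun 'I_k -> 'I_k} * {ffun 'I_k -> 'I_L}) : is_walk W q -> [/\ fixfree_involution q.1,
    forall i j : 'I_k, (i < j < q.1 i)%N -> (q.1 j < q.1 i)%N,
    forall i : 'I_k, W (q.1 i) = ~~ W i,
    forall i, q.2 (ordS (q.1 i)) = q.2 i /\ (q.2 (target eps i) < q.2 (source eps i))%N
    & forall y, exists i, q.2 i == y].
  move=> /and5P[/forallP H1 /forallP H2 /forallP H3 /forallP H4 /andP[/forallP H5 /forallP H6]].
  split=> [i|i j|i|i|y].
  - by have /andP[/eqP] := H1 i.
  - by have /forallP/(_ j)/implyP := H2 i.
  - exact/eqP.
  - by rewrite -monoE; split; [exact/eqP | exact: H5].
  - exact/existsP.
rewrite -[RHS](card_in_imset (f := psi)) => [|[s f] [s' f']]; last first.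
  rewrite !inE => /walkP[/= inv nc _ fg fo] /walkP[/= inv' nc' _ fg' fo'] [es].
  have {}es : s = s' by rewrite -(partner_pairs inv) -(partner_pairs inv') es.
  subst s' => eo; congr (_, _); apply/ffunP => i; apply: val_inj => /=.
  rewrite (label_rank inv nc (fun i => proj1 (fg i)) fo).
  by rewrite (label_rank inv nc (fun i => proj1 (fg' i)) fo') eo.
apply: eq_card => -[sigma lt]; rewrite inE /=.
apply/and5P/imsetP => [[P N C O M]|[[s f]]].
  have inv := partner_involution P.
  exists (partner sigma, rank_label sigma lt); last first.
    by rewrite /psi /= (pairs_partner P) rank_label_order.
  rewrite inE; apply/and5P; split; last apply/andP; [| | | |split]; apply/forallP => i /=.
  - by have [-> ->] := inv i; rewrite eqxx.
  - by apply/forallP => j; apply/implyP; apply: partner_nc.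
  - rewrite -oppE; have /forallP/(_ i)/forallP/(_ (partner sigma i))/implyP := C.
    by apply; case: (partnerP P i).
  - by rewrite rank_label_glue.
  - by rewrite monoE rank_label_mono.
  - by apply/existsP; exact: rank_label_onto.
rewrite inE => /walkP[/= inv nc lett fg fo] [-> ->].
split.
- exact: pairs_pairing.
- exact/noncrossing_pairs.
- apply/forallP => i; apply/forallP => j; apply/implyP; rewrite mem_pairs // => /eqP->.
  by rewrite oppE lett.
- by apply: label_order_total => // i; case: (fg i).
- by apply: label_order_compatible => // i; case: (fg i).
Qed.

End OrderedTrees.

(** * The sign sequence is a nested word *)

Lemma nth_flatten_block (T : Type) (x0 : T) (ss : seq (seq T)) b i :
  (b < size ss)%N -> (i < size (nth [::] ss b))%N ->
  nth x0 (flatten ss) (sumn (take b (shape ss)) + i) = nth x0 (nth [::] ss b) i.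
Proof.
elim: ss b => [|s ss IHss] [|b] //= ltb lti.
  by rewrite nth_cat lti.
by rewrite nth_cat -addnA ltnNge leq_addr /= addKn IHss.
Qed.

Lemma depth_take (s : seq nat) r : depth (nth 0%N s) r = sumn (take r s).
Proof.
elim: s r => [|x s IHs] [|r]; rewrite ?depth0 //=.
  by rewrite /depth big1_seq // => i _; rewrite nth_nil.
by rewrite /depth big_nat_recl //= -IHs.
Qed.

Section EpsWord.
Variables (m : nat) (l : m.-tuple nat).
Let D := sumn l.
Let W := nth false [seq e == 1 | e <- eps_tuple l].

Lemma eps_sign i : tnth (eps_tuple l) i = 1 \/ tnth (eps_tuple l) i = -1.
Proof.
have : tnth (eps_tuple l) i \in eps_seq l by exact: mem_tnth.
case/flatten_mapP => r _; rewrite mem_nseq => /andP[_ /eqP->].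
by rewrite -signr_odd; case: (odd r); [right | left].
Qed.

Lemma eps_block b p : (b < 2 * m)%N ->
  (sumn (take b (block_lengths l)) <= p
     < sumn (take b (block_lengths l)) + nth 0%N (block_lengths l) b)%N ->
  W p = ~~ odd b.
Proof.
move=> ltb /andP[leb ltp]; set g := fun r => nseq (nth 0%N (block_lengths l) r) ((-1) ^+ r : int).
have sbl : size (block_lengths l) = (2 * m)%N.
  by rewrite size_cat size_rev size_tuple addnn mul2n.
have shE : shape (mkseq g (2 * m)) = block_lengths l.
  rewrite /shape /mkseq -map_comp (eq_map (g := nth 0%N (block_lengths l))).
    by rewrite -sbl -/(mkseq _ _) mkseq_nth.
  by move=> r /=; rewrite size_nseq.
have szg : size (nth [::] (mkseq g (2 * m)) b) = nth 0%N (block_lengths l) b.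
  by rewrite nth_mkseq // size_nseq.
have e := @nth_flatten_block _ (0 : int) (mkseq g (2 * m)) b
  (p - sumn (take b (block_lengths l))).
rewrite shE szg subnKC // nth_mkseq // size_mkseq in e.
have ltp' : (p - sumn (take b (block_lengths l)) < nth 0%N (block_lengths l) b)%N.
  by rewrite ltn_subLR.
have {}e : nth 0 (eps_seq l) p = (-1) ^+ b.
  by rewrite /eps_seq -/g e // nth_nseq ltp'.
have ltps : (p < size (eps_seq l))%N.
  (* Beyond the end [nth] would return 0, which is not a sign. *)
  rewrite ltnNge; apply/negP => /(nth_default 0); rewrite e => /eqP.
  by rewrite signr_eq0.
rewrite /W (nth_map 0) // e -signr_odd.
by case: (odd b).
Qed.

Lemma eps_nested : nested_word m (nth 0%N l) W.
Proof.
move=> r ltrm; rewrite !depth_take.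
have sl : size l = m by rewrite size_tuple.
have tl : take m l = l by rewrite -{1}sl take_size.
have tS : sumn (take r.+1 l) = (sumn (take r l) + nth 0%N l r)%N.
  by rewrite (take_nth 0%N) ?sl // sumn_rcons.
have dropE q : (sumn (take q l) + sumn (drop q l))%N = D by rewrite -sumn_cat cat_take_drop.
rewrite tl -/D; split=> p Hp.
  have lb : (m - r.+1 < m)%N by lia.
  (* Counted from 0, the left run of length [l r] is block [m - r.+1] and the right one is block
     [m + r]. *)
  rewrite (@eps_block (m - r.+1)).
      by rewrite oddB // /up_level; case: (odd m) (odd r.+1) => [] [].
    by lia.
  have tE : take (m - r.+1) (block_lengths l) = rev (drop r.+1 l).
    rewrite /block_lengths takel_cat ?size_rev ?sl; last by lia.
    by rewrite take_rev sl; congr (rev (drop _ _)); lia.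
  rewrite tE sumn_rev /block_lengths nth_cat size_rev sl lb nth_rev ?sl //.
  have -> : (m - (m - r.+1).+1 = r)%N by lia.
  by have := dropE r.+1; have := dropE r; move: Hp; rewrite tS; lia.
rewrite (@eps_block (m + r)); [|lia|].
  by rewrite oddD /up_level /=; case: (odd m) (odd r) => [] [].
rewrite /block_lengths take_cat size_rev sl nth_cat size_rev sl.
rewrite ltnNge leq_addr /= addKn sumn_cat sumn_rev -/D.
by move: Hp; rewrite tS; lia.
Qed.

End EpsWord.

(** * Comparison of the two cardinalities *)

Lemma bijection_of_card (S T : finType) (A : {set S}) (B : {set T}) (t0 : T) :
  #|A| = #|B| -> exists f, bijection_between A B f.
Proof.
move=> eAB; pose f x := nth t0 (enum B) (index x (enum A)).
have ltf x : x \in A -> (index x (enum A) < size (enum B))%N.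
  by move=> xA; rewrite -cardE -eAB cardE index_mem mem_enum.
have fB x : x \in A -> f x \in B by move=> xA; rewrite -mem_enum mem_nth // ltf.
have inj : {in A &, injective f}.
  move=> x y xA yA /eqP; rewrite nth_uniq ?enum_uniq ?ltf // => /eqP e.
  rewrite -(nth_index x (s := enum A) (x := x)) ?mem_enum // e.
  by rewrite (nth_index x) // mem_enum.
exists f; split=> //; apply/eqP; rewrite eqEcard card_in_imset // eAB leqnn andbT.
by apply/subsetP => _ /imsetP[x xA ->]; exact: fB.
Qed.

Local Close Scope ring_scope.

Theorem theorem1p4 (m : nat) (l : m.-tuple nat)
    (m_gt0 : 0 < m)
    (l_gt0 : forall i : 'I_m, 0 < tnth l i)
    (l_le : forall i j : 'I_m, i <= j -> tnth l i <= tnth l j) :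
  (exists f, bijection_between (ordered_trees (eps_tuple l)) (set_tuples l) f)
  /\ bijection_between (sequences l) (set_tuples l) (@fibers m l).
Proof.
split; last exact: fibers_bijection.
apply: bijection_of_card; first exact: [ffun=> set0].
have dm : depth (nth 0%N l) m = sumn l by rewrite depth_take take_oversize ?size_tuple.
have lE r (lt : r < m) : nth 0 l r = tnth l (Ordinal lt) by rewrite (tnth_nth 0).
have lr_gt0 r : r < m -> 0 < nth 0 l r by move=> lt; rewrite (lE r lt).
have lr_le r q : r <= q < m -> nth 0 l r <= nth 0 l q.
  move=> /andP[lerq lt]; rewrite (lE q lt) (lE r (leq_ltn_trans lerq lt)).
  exact: l_le.
have d_gt0 : 0 < sumn l.
  case: m l m_gt0 dm lr_gt0 {l_gt0 l_le lE lr_le} => // m' l' _ <- H.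
  by rewrite depthS addn_gt0 H ?orbT.
have k_gt0 : 0 < 2 * sumn l by rewrite muln_gt0.
have [R [theta [theta2 indep]]] := exists_nilpotents (sumn l).+1.
set w := [seq e == 1%R | e <- eps_tuple l].
have size_w : size w = 2 * sumn l by rewrite size_map size_tuple.
(* The sum over all root labels is evaluated twice: as a sum over labelled trees here, and by
   peeling the nested blocks in [wordsE]. *)
have treeE := sum_tree_sum d_gt0 size_w theta2.
rewrite -(card_ordered_trees k_gt0 (@eps_sign m l)) in treeE.
have n_eq : 2 * sumn l = 2 * depth (nth 0 l) m by rewrite dm.
have em : m = m.-1.+1 by rewrite prednK.
have lr0 : 0 < nth 0 l m.-1 by apply: lr_gt0; rewrite prednK.
have wordsE := sum_nested_words (L := (sumn l).+1) theta2 lr_le (eps_nested l) n_eq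
  (fun x _ => tree_mx_balanced theta _ size_w x)
  (fun x i _ => tree_mx_diag theta _ w x i)
  (tree_mx_eq theta size_w) (i := ord0) (j := ord_max) em lr0 erefl erefl.
rewrite dm (tuple_sum_set_tuples l theta2) in wordsE.
move: treeE; rewrite (eq_bigr (fun x =>
  theta x * tree_mx theta (sumn l).+1 (2 * sumn l) w x ord0 ord_max)%R); last first.
  by move=> x _; rewrite tree_mx_corner // size_w.
rewrite wordsE => e.
(* Cancellation of the product of the weights: [indep] applied to the truncated difference gives one
   inequality at a time. *)
have le a b : ((\prod_(x < (sumn l).+1) theta x) *+ a =
               (\prod_(x < (sumn l).+1) theta x) *+ b)%R -> a <= b.
  move=> eab; rewrite -subn_eq0; have [leab|/ltnW leba] := leqP a b.
    by rewrite subn_eq0.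
  by apply/eqP/indep; rewrite mulrnBr // eab subrr.
by apply/eqP; rewrite eqn_leq (le _ _ e) (le _ _ (esym e)).
Qed.
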